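(* Let $2\le\xi<\omega_1$. Then there exists a partial function $f:\mathbb{Z}_+^\omega\times 2^\omega\rightarrowtail\mathbb{Z}^\omega$ satisfying: (i) $f$ is $\mathbf{\Sigma}^0_\xi$-measurable and $\mathrm{graph}(f)$ is the difference of two $\mathbf{\Pi}^0_\xi$ subsets of $\mathbb{Z}_+^\omega\times 2^\omega\times\mathbb{Z}^\omega$; (ii) for all $(a,x)\in\mathbb{Z}_+^\omega\times 2^\omega$, if $(a,x)\in\mathrm{dom}(f)$ then $f(a,x)\in\mathrm{supp}\,\mu_a$; (iii) for every $a\in\mathbb{Z}_+^\omega$ and every $S\in\mathbf{\Pi}^0_\xi(2^\omega\times\mathbb{Z}^\omega)$, if $\mathrm{graph}(f_a)\subseteq S$ then there exists $x\in 2^\omega$ with $\mu_a(S_x)>0$, where $f_a:2^\omega\rightarrowtail\mathbb{Z}^\omega$ is the partial function $f_a(x)=f(a,x)$ and $S_x=\{g\in\mathbb{Z}^\omega:(x,g)\in S\}$.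
   Context: $\mathbb{Z}_+$ is the set of positive integers; $\mathbb{Z}_+^\omega$, $\mathbb{Z}^\omega$ carry the product of discrete topologies and $2^\omega$ is the Cantor space. A partial function $f:X\rightarrowtail Y$ is $\mathbf{\Sigma}^0_\xi$-measurable if the preimages of open subsets of $Y$ are $\mathbf{\Sigma}^0_\xi$ subsets of $X$. For a positive integer $k$, $\varrho_k$ is the uniform probability measure on $\llbracket 0,k\rrbracket=[0,k]\cap\mathbb{Z}$, i.e. $\varrho_k(X)=\frac{|X\cap\llbracket 0,k\rrbracket|}{k+1}$ for $X\subseteq\mathbb{Z}$. For $a\in\mathbb{Z}_+^\omega$, $\mu_a=\bigotimes_{n\in\omega}\varrho_{a(n)}$ is the product Borel probability measure on $\mathbb{Z}^\omega$; its support is $\mathrm{supp}\,\mu_a=\prod_{n\in\omega}\llbracket 0,a(n)\rrbracket$. *)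

(* Defs.v *)
From HB Require Import structures.
From mathcomp Require Import all_boot all_order all_algebra.
From mathcomp Require Import all_classical all_reals all_analysis.
From mathcomp Require Import Rstruct Rstruct_topology.

Set Implicit Arguments.
Unset Strict Implicit.
Unset Printing Implicit Defensive.

Import Order.TTheory GRing.Theory Num.Theory.
Import numFieldNormedType.Exports.

Local Open Scope classical_set_scope.
Local Open Scope ring_scope.

(* Countable ordinals as Brouwer trees (every countable ordinal is     *)
(* represented; OL f denotes sup_k f k).                               *)
Inductive ord : Type :=
| OZ : ord
| OS : ord -> ord
| OL : (nat -> ord) -> ord.

(* The standard order on Brouwer trees: ord_le x y <-> |x| <= |y|. *)
Inductive ord_le : ord -> ord -> Prop :=
| ord_le_zero y : ord_le OZ y
| ord_le_succ x y : ord_le x y -> ord_le (OS x) (OS y)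
| ord_le_cocone x (f : nat -> ord) k : ord_le x (f k) -> ord_le x (OL f)
| ord_le_limiting (f : nat -> ord) y : (forall k, ord_le (f k) y) -> ord_le (OL f) y.

Definition ord_lt (x y : ord) : Prop := ord_le (OS x) y.

Definition ord1 : ord := OS OZ.
Definition ord2 : ord := OS (OS OZ).

Inductive Sigma0 (T : topologicalType) : ord -> set T -> Prop :=
| Sigma0_open xi (A : set T) :
    ord_le ord1 xi -> ord_le xi ord1 -> open A -> Sigma0 xi A
| Sigma0_union xi (eta : nat -> ord) (B : nat -> set T) :
    ord_lt ord1 xi ->
    (forall n, ord_le ord1 (eta n) /\ ord_lt (eta n) xi) ->
    (forall n, Sigma0 (eta n) (~` B n)) ->
    Sigma0 xi (\bigcup_n B n).

Definition Pi0 (T : topologicalType) (xi : ord) (A : set T) : Prop :=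
  Sigma0 xi (~` A).

Definition Zpos : Type := {k : int | 0 < k}.

Definition Zpos_omega : Type :=
  prod_topology (fun _ : nat => discrete_topology Zpos).
Definition Z_omega : Type :=
  prod_topology (fun _ : nat => discrete_topology int).

(* A partial function X >-> Y is given by its domain D and a total     *)
(* function f : X -> Y whose values outside D are irrelevant.          *)
Definition pgraph (X Y : Type) (D : set X) (f : X -> Y) : set (X * Y) :=
  [set p | D p.1 /\ f p.1 = p.2].

Definition psigma_measurable (X Y : topologicalType) (xi : ord)
    (D : set X) (f : X -> Y) : Prop :=
  forall U : set Y, open U -> Sigma0 xi [set x | D x /\ U (f x)].

Definition aval (a : Zpos_omega) (n : nat) : int := val (a n).

Definition rho1 (k : int) (z : int) : Rdefinitions.R :=
  if (0 <= z) && (z <= k) then (k + 1)%:~R^-1 else 0.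

Definition cyl (s : seq int) : set (nat -> int) :=
  [set g | forall i, (i < size s)%N -> g i = nth 0 s i].

Definition cyl_mass (a : Zpos_omega) (s : seq int) : Rdefinitions.R :=
  \prod_(i < size s) rho1 (aval a i) (nth 0 s i).

(* mu_a(B): the Caratheodory (outer) measure generated by the product  *)
(* premeasure on cylinders; on Borel sets it is the product measure    *)
(* (x)_n rho_{a(n)}.                                                   *)
Definition mu (a : Zpos_omega) (B : set Z_omega) : \bar Rdefinitions.R :=
  ereal_inf [set (\sum_(k <oo) (cyl_mass a (s k))%:E)%E |
             s in [set s : nat -> seq int | B `<=` \bigcup_k cyl (s k)]].

Definition supp_mu (a : Zpos_omega) : set Z_omega :=
  [set g | forall n, 0 <= g n <= aval a n].

Definition section (X Y : Type) (S : set (X * Y)) (x : X) : set Y :=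
  [set y | S (x, y)].

(* Main.v *)
(** If [S] is [Pi0 xi], its complement is the section [U c] of a universal
    [Sigma0 xi] set [U].  It is enough to find, uniformly in [(a, x)], a point
    [f (a, x)] of [P_(a, x) = {g | (x, (x, g)) \in U}] whenever [P_(a, x)] is not
    of small [mu a]-measure: a null section [S_c] leaves [P_(a, c)] of full
    measure, so [f (a, c)] is defined, and the point [(c, f (a, c))] of the graph
    lies outside [S].

    To select points, write [P] as a union of sets [B n] with
    [~` B n] in [Sigma0 (eta n)], [eta n < xi].  By induction on the Borel rank,
    each [~` B n] is contained, up to an arbitrarily small error in measure on
    every section, in a set whose sections are open and generated by a tree of
    words depending on [(a, x)] in a [Sigma0 (eta n)] way.  The complement of that
    set has closed sections contained in [B n]; as the support of [mu a] is
    compact, it is a [Pi0 (eta n)] condition that the cylinder of a given word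
    meets such a section inside the support, so that following the leftmost branch
    for the least possible [n] is a [Sigma0 xi]-measurable selection. *)

Require Import Defs.
From HB Require Import structures.
From mathcomp Require Import all_boot all_order all_algebra.
From mathcomp Require Import all_classical all_reals all_analysis.
From mathcomp Require Import Rstruct Rstruct_topology.
From mathcomp Require Import ring lra.

Set Implicit Arguments.
Unset Strict Implicit.
Unset Printing Implicit Defensive.

Import Order.TTheory GRing.Theory Num.Theory.

Local Open Scope classical_set_scope.
Local Open Scope ring_scope.

Local Notation ord1 := Defs.ord1.
Local Notation R := Rdefinitions.R.

(** * Brouwer ordinals and the Borel hierarchy *)

Lemma ord_le_refl x : ord_le x x.
Proof.
elim: x => [|x IH|f IH]; [exact: ord_le_zero | exact: ord_le_succ |].
by apply: ord_le_limiting => k; apply: (ord_le_cocone (k := k)).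
Qed.

(** Induction on the derivation rather than inversion: its last rule may be [ord_le_cocone], which
    acts on the right-hand side and hides the limit on the left. *)
Lemma ord_le_OL_inv f k z : ord_le (OL f) z -> ord_le (f k) z.
Proof.
move e: (OL f) => y h; elim: h e => // {y z}.
- by move=> x g j _ IH e; apply: (ord_le_cocone (k := j)); apply: IH.
- by move=> g y h _ [->].
Qed.

Lemma ord_le_OS_inv x y : ord_le (OS x) (OS y) -> ord_le x y.
Proof. by move=> h; inversion h. Qed.

Lemma ord_le_OS_OL_inv x f : ord_le (OS x) (OL f) -> exists k, ord_le (OS x) (f k).
Proof. by move=> h; inversion h; exists k. Qed.

Lemma ord_le_trans y x z : ord_le x y -> ord_le y z -> ord_le x z.
Proof.
move=> h; elim: h z => {x y}.
- by move=> y z _; exact: ord_le_zero.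
- move=> x y _ IH z; move e: (OS y) => t h; elim: h e => // {t z}.
  + by move=> t z h _ [e]; apply: ord_le_succ; apply: IH; rewrite e.
  + by move=> t f k _ IH' e; apply: (ord_le_cocone (k := k)); apply: IH'.
- by move=> x f k _ IH z h; apply: IH; exact: ord_le_OL_inv h.
- by move=> f y _ IH z h; apply: ord_le_limiting => k; apply: IH.
Qed.

Lemma ord_le_OS x : ord_le x (OS x).
Proof.
elim: x => [|x IH|f IH]; [exact: ord_le_zero | exact: ord_le_succ |].
apply: ord_le_limiting => k; apply: ord_le_trans (IH k) _.
by apply: ord_le_succ; apply: (ord_le_cocone (k := k)); exact: ord_le_refl.
Qed.

Lemma ord_ltW x y : ord_lt x y -> ord_le x y.
Proof. by apply: ord_le_trans; exact: ord_le_OS. Qed.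

(** Distinct trees may represent the same ordinal, so comparison is decided by nested induction,
    with excluded middle to settle whether some member of a sequence goes far enough. *)
Lemma ord_le_total x y : ord_le x y \/ ord_lt y x.
Proof.
elim: x y => [|x IH|f IH] y; first by left; exact: ord_le_zero.
  elim: y => [|y _|g IHg].
  - by right; apply: ord_le_succ; exact: ord_le_zero.
  - by case: (IH y) => h; [left | right]; exact: ord_le_succ.
  - case: (pselect (exists k, ord_le (OS x) (g k))) => [[k h]|h].
      by left; exact: ord_le_cocone h.
    right; apply: ord_le_succ; apply: ord_le_limiting => k.
    case: (IHg k) => [h'|]; first by case: h; exists k.
    exact: ord_le_OS_inv.
case: (pselect (forall k, ord_le (f k) y)) => [h|/existsNP[k h]].
  by left; exact: ord_le_limiting.
by right; apply: (ord_le_cocone (k := k)); case: (IH k y).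
Qed.

(** At a limit [xi], infinitely many ranks below [xi] may have supremum [xi]. Finitely many have a
    largest one, so that finite intersections stay strictly below [xi]. *)
Lemma ord_max_lt (P : ord -> Prop) (eta : nat -> ord) xi n :
  (forall i, P (eta i) /\ ord_lt (eta i) xi) ->
  exists z, [/\ P z, ord_lt z xi & forall i, (i <= n)%N -> ord_le (eta i) z].
Proof.
move=> h; elim: n => [|n [z [Pz zxi hz]]].
  have [? ?] := h 0%N; exists (eta 0%N); split=> // i; rewrite leqn0 => /eqP ->.
  exact: ord_le_refl.
have [Pn nxi] := h n.+1.
case: (ord_le_total (eta n.+1) z) => hn.
  exists z; split=> // i; rewrite leq_eqVlt => /orP[/eqP -> //|]; exact: hz.
exists (eta n.+1); split=> // i; rewrite leq_eqVlt => /orP[/eqP ->|hi].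
  exact: ord_le_refl.
by apply: ord_le_trans (ord_ltW hn); exact: hz.
Qed.

(** * Countable clopen bases and closure properties of the hierarchy *)

Definition clopen_basis (T : topologicalType) (C : nat -> set T) :=
  (forall n, clopen (C n)) /\
  (forall (U : set T) x, open U -> U x -> exists2 n, C n x & C n `<=` U).

Definition clopen_based (T : topologicalType) := exists C : nat -> set T, clopen_basis C.

Lemma clopen_setC (T : topologicalType) (A : set T) : clopen A -> clopen (~` A).
Proof. by move=> [oA cA]; split; [rewrite openC | rewrite closedC]. Qed.

Lemma open_bigcup_clopen (T : topologicalType) (C : nat -> set T) (U : set T) :
  clopen_basis C -> open U ->
  U = \bigcup_n (if `[< C n `<=` U >] then C n else set0).
Proof.
move=> [_ hC] oU; rewrite eqEsubset; split=> x.
  by move=> /(hC _ _ oU)[n Cx CU]; exists n => //; case: asboolP.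
by move=> [n _]; case: asboolP => // CU /CU.
Qed.

Section BorelCalculus.
Variable T : topologicalType.
Implicit Types (A B : set T) (xi eta : ord).

Lemma Sigma0_ge1 xi A : Sigma0 xi A -> ord_le ord1 xi.
Proof. by case=> // {}xi e B h _ _; exact: ord_ltW. Qed.

Lemma Sigma0_inv xi A : Sigma0 xi A ->
  (ord_le xi ord1 /\ open A) \/
  [/\ ord_lt ord1 xi & exists (eta : nat -> ord) (B : nat -> set T),
   [/\ A = \bigcup_n B n, (forall n, ord_le ord1 (eta n) /\ ord_lt (eta n) xi) &
    forall n, Sigma0 (eta n) (~` B n)]].
Proof.
case=> {xi A}[xi A|xi eta B] h1 h2 h3; first by left.
by right; split=> //; exists eta, B.
Qed.

Hypothesis Tb : clopen_based T.

Lemma clopen_Sigma0 xi A : ord_le ord1 xi -> clopen A -> Sigma0 xi A.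
Proof.
move=> h1 cA; case: (ord_le_total xi ord1) => h2.
  by apply: Sigma0_open => //; case: cA.
rewrite -(@bigcup_const _ nat setT A); last by exists 0%N.
apply: (Sigma0_union (eta := fun=> ord1)) => // n.
  by split=> //; exact: ord_le_refl.
by apply: Sigma0_open; [exact: ord_le_refl..|case: (clopen_setC cA)].
Qed.

Lemma open_Sigma0 xi A : ord_le ord1 xi -> open A -> Sigma0 xi A.
Proof.
move=> h1 oA; case: (ord_le_total xi ord1) => h2; first exact: Sigma0_open.
have [C bC] := Tb; rewrite (open_bigcup_clopen bC oA).
apply: (Sigma0_union (eta := fun=> ord1)) => // n.
  by split=> //; exact: ord_le_refl.
apply: clopen_Sigma0; first exact: ord_le_refl.
apply: clopen_setC; case: ifP => _; first by case: bC.
exact: clopen0.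
Qed.

(** Above the first level the same union serves for the larger rank. An open set has to be split
    into clopen sets, which is where the basis comes in. *)
Lemma Sigma0_le eta xi A : Sigma0 eta A -> ord_le eta xi -> Sigma0 xi A.
Proof.
move=> sA le; have := Sigma0_inv sA.
case=> [[_ oA]|[h1 [e [B [-> h2 h3]]]]].
  by apply: open_Sigma0 => //; exact: ord_le_trans (Sigma0_ge1 sA) le.
apply: (Sigma0_union (eta := e)) => //; first exact: ord_le_trans h1 le.
by move=> n; have [? ?] := h2 n; split=> //; apply: ord_le_trans le.
Qed.

Lemma Sigma0_setC_lt eta xi A : Sigma0 eta A -> ord_lt eta xi -> Sigma0 xi (~` A).
Proof.
move=> sA lt; rewrite -(@bigcup_const _ nat setT (~` A)); last by exists 0%N.
have h1 := Sigma0_ge1 sA.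
apply: (Sigma0_union (eta := fun=> eta)) => //.
  by apply: ord_le_trans lt; exact: ord_le_succ.
by move=> _; rewrite setCK.
Qed.

Lemma Sigma0_inv_open xi A : ord_le xi ord1 -> Sigma0 xi A -> open A.
Proof.
move=> h /Sigma0_inv[[]//|[h' _]].
by have /ord_le_OS_inv h2 := ord_le_trans h' h; inversion h2.
Qed.

Lemma Sigma0_inv_bigcup xi A : ord_lt ord1 xi -> Sigma0 xi A ->
  exists (eta : nat -> ord) (B : nat -> set T),
   [/\ A = \bigcup_n B n, (forall n, ord_le ord1 (eta n) /\ ord_lt (eta n) xi) &
    forall n, Sigma0 (eta n) (~` B n)].
Proof.
move=> lt sA; case: (Sigma0_inv sA) => [[h oA]|[]//].
have [C bC] := Tb; have eA := open_bigcup_clopen bC oA.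
exists (fun=> ord1), (fun n => if `[< C n `<=` A >] then C n else set0).
split=> // n; first by split=> //; exact: ord_le_refl.
apply: clopen_Sigma0; first exact: ord_le_refl.
apply: clopen_setC; case: ifP => _; first by case: bC.
exact: clopen0.
Qed.

Lemma Sigma0_bigcup xi (A : nat -> set T) :
  (forall n, Sigma0 xi (A n)) -> Sigma0 xi (\bigcup_n A n).
Proof.
move=> sA; have h1 := Sigma0_ge1 (sA 0%N).
case: (ord_le_total xi ord1) => h2.
  apply: Sigma0_open => //; apply: bigcup_open => n _.
  exact: Sigma0_inv_open h2 (sA n).
have /choice[eta /choice[B hB]] := fun n => Sigma0_inv_bigcup h2 (sA n).
(* The default pair for numbers that code nothing only repeats one of the sets of the union. *)
pose pr (k : nat) := odflt (0%N, 0%N) (unpickle k).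
have -> : \bigcup_n A n = \bigcup_k B (pr k).1 (pr k).2.
  rewrite eqEsubset; split=> x.
    move=> [n _]; have [-> _ _] := hB n; move=> [m _ Bx].
    by exists (pickle (n, m)) => //; rewrite /pr pickleK.
  by move=> [k _ Bx]; exists (pr k).1 => //; have [-> _ _] := hB (pr k).1; exists (pr k).2.
apply: (Sigma0_union (eta := fun k => eta (pr k).1 (pr k).2)) => // k.
  by have [_ h _] := hB (pr k).1; exact: h.
by have [_ _ h] := hB (pr k).1; exact: h.
Qed.

Lemma Sigma0_bigcupT xi (I : countType) (A : I -> set T) :
  ord_le ord1 xi -> (forall i, Sigma0 xi (A i)) -> Sigma0 xi (\bigcup_i A i).
Proof.
move=> h1 sA.
have -> : \bigcup_i A i = \bigcup_n oapp A set0 (unpickle n).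
  rewrite eqEsubset; split=> x [i _ Ax].
    by exists (pickle i) => //; rewrite pickleK.
  by move: Ax; case e: unpickle => [j|] //= Ax; exists j.
apply: Sigma0_bigcup => n; case: unpickle => [i|] //=; apply: clopen_Sigma0 => //.
exact: clopen0.
Qed.

Lemma Sigma0_setU xi A B : Sigma0 xi A -> Sigma0 xi B -> Sigma0 xi (A `|` B).
Proof.
move=> sA sB; rewrite -bigcup2E; apply: Sigma0_bigcup => -[|[|n]] //=.
apply: clopen_Sigma0; first exact: Sigma0_ge1 sA.
exact: clopen0.
Qed.

Lemma Sigma0_setI xi A B : Sigma0 xi A -> Sigma0 xi B -> Sigma0 xi (A `&` B).
Proof.
move=> sA sB; have h1 := Sigma0_ge1 sA.
case: (ord_le_total xi ord1) => h2.
  by apply: Sigma0_open => //; apply: openI; exact: Sigma0_inv_open h2 _.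
have [eA [C [-> hA sC]]] := Sigma0_inv_bigcup h2 sA.
have [eB [D [-> hB sD]]] := Sigma0_inv_bigcup h2 sB.
have -> : \bigcup_n C n `&` \bigcup_n D n = \bigcup_(p : nat * nat) (C p.1 `&` D p.2).
  rewrite eqEsubset; split=> x.
    by move=> [[n _ Cx] [m _ Dx]]; exists (n, m).
  by move=> [[n m] _ [Cx Dx]]; split; [exists n | exists m].
apply: Sigma0_bigcupT => // -[n m] /=.
have [hA1 hA2] := hA n; have [hB1 hB2] := hB m.
(* The complement of the intersection is the union of two complements, which has the larger of the
   two ranks, still below [xi]. *)
case: (ord_le_total (eA n) (eB m)) => h; rewrite -[C n `&` D m]setCK;
  [apply: (Sigma0_setC_lt (eta := eB m)) hB2 |
   apply: (Sigma0_setC_lt (eta := eA n)) hA2];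
  rewrite setCI; apply: Sigma0_setU => //.
- exact: Sigma0_le h.
- exact: Sigma0_le (ord_ltW h).
Qed.

Lemma Sigma0_bigcap_seq xi (I : eqType) (l : seq I) (A : I -> set T) :
  ord_le ord1 xi -> (forall i, i \in l -> Sigma0 xi (A i)) ->
  Sigma0 xi [set x | forall i, i \in l -> A i x].
Proof.
move=> h1; elim: l => [|i l IH] sA.
  apply: clopen_Sigma0 => //.
  rewrite (_ : [set _ | _] = setT); first exact: clopenT.
  by rewrite eqEsubset; split.
rewrite (_ : [set _ | _] = A i `&` [set x | forall i, i \in l -> A i x]).
  apply: Sigma0_setI; first by apply: sA; rewrite mem_head.
  by apply: IH => j jl; apply: sA; rewrite in_cons jl orbT.
rewrite eqEsubset; split=> x /=.
  move=> h; split; first by apply: h; rewrite mem_head.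
  by move=> j jl; apply: h; rewrite in_cons jl orbT.
by move=> [Ax h] j; rewrite in_cons => /orP[/eqP -> //|]; exact: h.
Qed.

Lemma Pi0_bigcap xi (I : countType) (A : I -> set T) : ord_le ord1 xi ->
  (forall i, Pi0 xi (A i)) -> Pi0 xi [set x | forall i, A i x].
Proof.
move=> h1 pA; rewrite /Pi0.
have -> : ~` [set x | forall i, A i x] = \bigcup_i ~` A i.
  rewrite eqEsubset; split=> x /=; first by move=> /existsNP[i h]; exists i.
  by move=> [i _ h] /(_ i).
exact: Sigma0_bigcupT.
Qed.
End BorelCalculus.

Lemma Sigma0_preimage (S T : topologicalType) (f : S -> T) xi (A : set T) :
  continuous f -> Sigma0 xi A -> Sigma0 xi (f @^-1` A).
Proof.
move=> cf; elim=> {xi A}[xi A h1 h2 oA|xi eta B h1 h2 _ IH].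
  by apply: Sigma0_open => //; exact: open_comp.
by rewrite preimage_bigcup; apply: (Sigma0_union (eta := eta)).
Qed.

Lemma continuous_pair (S T T' : topologicalType) (f : S -> T) (g : S -> T') :
  continuous f -> continuous g -> continuous (fun t => (f t, g t)).
Proof. by move=> cf cg t; exact: (cvg_pair (cf t) (cg t)). Qed.

Lemma clopen_basedW (T : topologicalType) (I : countType) (C : I -> set T) :
  (forall i, clopen (C i)) ->
  (forall (U : set T) x, open U -> U x -> exists2 i, C i x & C i `<=` U) ->
  clopen_based T.
Proof.
move=> cC hC; exists (fun n => oapp C set0 (unpickle n)); split=> [n|U x oU Ux].
  by case: unpickle => [i|] //=; exact: clopen0.
by have [i Ci CU] := hC U x oU Ux; exists (pickle i); rewrite pickleK.
Qed.

Lemma clopen_based_prod (S T : topologicalType) :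
  clopen_based S -> clopen_based T -> clopen_based (S * T)%type.
Proof.
move=> [C [cC hC]] [D [cD hD]].
apply: (@clopen_basedW _ (nat * nat)%type (fun i => C i.1 `*` D i.2)) => [[i j] /=|U [x y] oU Uxy].
  rewrite (_ : _ `*` _ = (fst @^-1` C i) `&` (snd @^-1` D j)) //.
  apply: clopenI; apply: preimage_clopen => //; move=> p; [exact: cvg_fst | exact: cvg_snd].
have : nbhs (x, y) U by exact: open_nbhs_nbhs.
move=> [[P Q] [/= nP nQ] PQ].
move: nP nQ; rewrite !nbhsE => -[P' [oP' P'x] P'P] [Q' [oQ' Q'y] Q'Q].
have [i Ci CP] := hC _ _ oP' P'x; have [j Dj DQ] := hD _ _ oQ' Q'y.
exists (i, j) => //= -[x' y'] /= [Cx Dy]; apply: PQ; split=> /=.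
  by apply: P'P; apply: CP.
by apply: Q'Q; apply: DQ.
Qed.

(** * Sequences over a discrete alphabet *)

Section SequenceSpaces.
Variable K : discreteTopologicalType.
Local Notation X := (prod_topology (fun _ : nat => K)).

Lemma finite_dep_open (A : set X) n :
  (forall x y : X, (forall i, (i < n)%N -> x i = y i) -> A x -> A y) -> open A.
Proof.
move=> hA; rewrite openE => x Ax; rewrite /interior.
apply: (filterS (P := [set y : X | forall i, (i < n)%N -> x i = y i])).
  by move=> y /hA; apply.
elim: n {hA} => [|n IH]; first by apply: filterS filterT => y _ i.
have h : nbhs x [set y : X | x n = y n].
  by apply: (@proj_continuous nat (fun=> K) n x [set y | x n = y]); rewrite nbhs_principalE.
apply: filterS2 IH h => y h1 h2 i; rewrite ltnS leq_eqVlt => /orP[/eqP -> //|].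
exact: h1.
Qed.

Lemma finite_dep_clopen (A : set X) n :
  (forall x y : X, (forall i, (i < n)%N -> x i = y i) -> A x -> A y) -> clopen A.
Proof.
move=> hA; split; first exact: finite_dep_open hA.
rewrite -openC; apply: (finite_dep_open (n := n)) => x y h nA Ay; apply: nA.
by apply: hA Ay => i /h.
Qed.

(** The sets of sequences that share a long prefix with [x] generate a filter [F]. It converges to
    [x] in each coordinate, hence for the supremum of the coordinate topologies. *)
Lemma prod_nbhs_finite_dep (x : X) (U : set X) : nbhs x U ->
  exists n, forall y : X, (forall i, (i < n)%N -> y i = x i) -> U y.
Proof.
pose F : set_system X :=
  filter_from setT (fun n : nat => [set y : X | forall i, (i < n)%N -> y i = x i]).
have FF : Filter F.
  apply: filter_from_filter; first by exists 0%N.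
  move=> i j _ _; exists (maxn i j) => // y h; split=> k hk; apply: h;
    by rewrite leq_max hk ?orbT.
have cF : F --> x.
  apply/cvg_sup => N V [W] [[Q] oQ <-] QN WV.
  by exists N.+1 => // y h; apply: WV => /=; rewrite h.
by move=> /cF [n _ h]; exists n.
Qed.

Lemma clopen_based_seq (e : K -> nat) : injective e -> clopen_based X.
Proof.
move=> inj_e.
apply: (@clopen_basedW _ (seq nat)
  (fun s => [set x : X | forall i, (i < size s)%N -> e (x i) = nth 0%N s i])) => [s|U x oU Ux].
  by apply: (@finite_dep_clopen _ (size s)) => x y h hx i hi; rewrite -h ?hx.
have [n hn] := prod_nbhs_finite_dep (open_nbhs_nbhs (conj oU Ux)).
exists (mkseq (e \o x) n) => /= [i|y hy].
  by rewrite size_mkseq => hi; rewrite nth_mkseq.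
apply: hn => i hi; apply: inj_e; rewrite hy ?size_mkseq //.
by rewrite nth_mkseq.
Qed.

Lemma continuous_into_seq (T : topologicalType) (f : T -> X) :
  (forall i, continuous (fun t => f t i)) -> continuous f.
Proof.
move=> cf t U /prod_nbhs_finite_dep[n hn].
suff : nbhs t [set t' | forall i, (i < n)%N -> f t' i = f t i].
  by apply: filterS => t' h; apply: hn.
elim: n {hn} => [|n IH]; first by apply: filterS filterT => y _ i.
have h : nbhs t [set t' | f t' n = f t n].
  by apply: (cf n t [set y | y = f t n]); rewrite nbhs_principalE.
apply: filterS2 IH h => y h1 h2 i; rewrite ltnS leq_eqVlt => /orP[/eqP -> //|].
exact: h1.
Qed.
End SequenceSpaces.

Lemma clopen_based_cantor : clopen_based cantor_space.
Proof. by apply: (@clopen_based_seq _ nat_of_bool); do 2 case. Qed.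

Lemma clopen_based_Z : clopen_based Z_omega.
Proof.
exact: (@clopen_based_seq (discrete_topology int) (pickle : int -> nat) (pcan_inj pickleK)).
Qed.

Lemma clopen_based_Zpos : clopen_based Zpos_omega.
Proof.
by apply: (@clopen_based_seq (discrete_topology Zpos) (fun z : Zpos => pickle (val z)))
  => x y /(pcan_inj pickleK) /val_inj.
Qed.

(** One point of the Cantor space carries countably many codes, one for each member of a union. *)
Definition cantor_row (c : cantor_space) (n : nat) : cantor_space :=
  fun m => c (pickle (n, m)).

Lemma cantor_row_continuous n : continuous (cantor_row^~ n).
Proof.
apply: continuous_into_seq => m.
exact: (@proj_continuous nat (fun=> bool) (pickle (n, m))).
Qed.

Lemma cantor_row_surj (x : nat -> cantor_space) : exists c, forall n, cantor_row c n = x n.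
Proof.
exists (fun k => if unpickle k is Some p then x p.1 p.2 else false) => n.
by apply: functional_extensionality_dep => m; rewrite /cantor_row pickleK.
Qed.

(** * Universal sets *)

Section Universal.
Variable Y : topologicalType.
Hypothesis Yb : clopen_based Y.

Definition universal xi (U : set (cantor_space * Y)) :=
  Sigma0 xi U /\ forall A, Sigma0 xi A -> exists c, A = section U c.

(** A code is the characteristic function of a set of indices of basic clopen sets, and its section
    is their union. *)
Lemma universal_open xi : ord_le ord1 xi -> ord_le xi ord1 -> exists U, universal xi U.
Proof.
move=> h1 h2; have [C bC] := Yb.
exists (\bigcup_n ((fun p => p.1 n = true) `&` (snd @^-1` C n))); split.
  apply: Sigma0_open => //; apply: bigcup_open => n _; apply: openI.
    apply: (@open_comp _ _ (fun p : cantor_space * Y => p.1 n) [set true]).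
      move=> p _; apply: (@continuous_comp _ _ _ fst (fun x : cantor_space => x n)).
        exact: cvg_fst.
      exact: (@proj_continuous nat (fun=> bool) n).
    exact: discrete_open.
  apply: open_comp; first by move=> p _; exact: cvg_snd.
  by case: bC => /(_ n) [].
move=> A /(Sigma0_inv_open h2) oA.
exists (fun n => `[< C n `<=` A >]); rewrite {1}(open_bigcup_clopen bC oA).
rewrite eqEsubset; split=> y [n _].
  by case: ifP => //= h Cy; exists n.
by move=> [/= h Cy]; exists n => //; rewrite h.
Qed.

(** Row [n] of a code describes, through a universal set of smaller rank, the complement of the
    [n]-th member of a union. The rank used is read off from [n] as the first half of a pair, so
    each rank is available at infinitely many positions. *)
Lemma universal_lim xi (eta : nat -> ord) (V : nat -> set (cantor_space * Y)) :
  ord_lt ord1 xi ->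
  (forall k, ord_lt (eta k) xi) ->
  (forall z, ord_lt z xi -> exists k, ord_le z (eta k)) ->
  (forall k, ord_le ord1 (eta k) -> universal (eta k) (V k)) ->
  exists U, universal xi U.
Proof.
move=> h1 lt cof uV.
have [k1 hk1] := cof _ h1.
(* A rank below [ord1] has no universal set to offer, and [k1] replaces it. *)
pose ka (n : nat) := let k := (odflt (0%N, 0%N) (unpickle n)).1 in
  if `[< ord_le ord1 (eta k) >] then k else k1.
have hka n : ord_le ord1 (eta (ka n)) by rewrite /ka; case: asboolP.
exists (\bigcup_n ~` ((fun p => (cantor_row p.1 n, p.2)) @^-1` V (ka n))); split.
  apply: (Sigma0_union (eta := eta \o ka)) => //= n; rewrite setCK.
  apply: Sigma0_preimage; last by case: (uV _ (hka n)).
  apply: continuous_pair; last by move=> p; exact: cvg_snd.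
  move=> p; apply: (@continuous_comp _ _ _ fst (cantor_row^~ n)); first exact: cvg_fst.
  exact: cantor_row_continuous.
move=> A sA; have [e [B [-> he sB]]] := Sigma0_inv_bigcup Yb h1 sA.
have /choice[k hk] : forall n, exists k, ord_le (e n) (eta k).
  by move=> n; have [_ /cof] := he n.
have hk' n : ord_le ord1 (eta (k n)) by apply: ord_le_trans (hk n); case: (he n).
pose jn (n : nat) := (odflt (0%N, 0%N) (unpickle n)).2.
(* At a position whose rank is not the one chosen for [B (jn n)], the row codes the whole space,
   whose complement adds nothing to the union. *)
have /choice[x hx] : forall n, exists c,
    (if `[< k (jn n) = (odflt (0%N, 0%N) (unpickle n)).1 >] then ~` B (jn n) else setT)
    = section (V (ka n)) c.
  move=> n; have [_] := uV _ (hka n); apply; case: asboolP => h.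
    rewrite /ka -h; case: asboolP => [_|/(_ (hk' _))//].
    exact: Sigma0_le (hk _).
  by apply: clopen_Sigma0 => //; exact: clopenT.
have [c hc] := cantor_row_surj x; exists c.
rewrite eqEsubset; split=> y [n _].
  move=> By; exists (pickle (k n, n)) => //= Vy.
  have := hx (pickle (k n, n)); rewrite /jn pickleK /=; case: asboolP => // _ e'.
  by have : (~` B n) y by rewrite e' /Defs.section /= -hc.
rewrite /= hc => nV.
have := hx n; case: asboolP => [_|_] en.
  exists (jn n) => //; apply: contrapT => nB; apply: nV.
  by have : section (V (ka n)) (x n) y by rewrite -en.
by case: nV; have : section (V (ka n)) (x n) y by rewrite -en.
Qed.

Lemma universal_exists xi : ord_le ord1 xi -> exists U, universal xi U.
Proof.
elim: xi => [h|xi IH|f IH h1]; first by inversion h.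
  case: (ord_le_total ord1 xi) => [h1 _|h0 h1].
    have [U uU] := IH h1.
    apply: (@universal_lim _ (fun=> xi) (fun=> U)) => //.
    - exact: ord_le_succ.
    - by move=> _; exact: ord_le_refl.
    - by move=> z /ord_le_OS_inv; exists 0%N.
  by apply: universal_open => //; apply: ord_le_succ; exact: ord_le_OS_inv.
case: (ord_le_total (OL f) ord1) => [|lt1]; first exact: universal_open.
(* A tree [OL f] need not be a limit ordinal. If some [f k] attains the supremum its universal set
   serves; otherwise the sequence [f] is cofinal and lies strictly below. *)
case: (pselect (exists k, ord_le (OL f) (f k))) => [[k hk]|nk].
  have [U [sU hU]] := IH k (ord_le_trans h1 hk).
  exists U; split=> [|A sA]; last by apply: hU; exact: Sigma0_le hk.
  by apply: Sigma0_le sU _ => //; [exact: clopen_based_prod clopen_based_cantor Yb |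
     exact: ord_le_OL_inv (ord_le_refl _)].
have /choice[V hV] : forall k, exists V, ord_le ord1 (f k) -> universal (f k) V.
  move=> k; case: (pselect (ord_le ord1 (f k))) => [/IH[V uV]|n1].
    by exists V.
  by exists set0 => /n1.
apply: (@universal_lim _ f V) => //.
  by move=> k; case: (ord_le_total (OL f) (f k)) => // hk; case: nk; exists k.
by move=> z /ord_le_OS_OL_inv[k hk]; exists k; exact: ord_ltW.
Qed.
End Universal.

(** * The outer measure on integer sequences *)

Lemma take_mkseq (K : Type) (g : nat -> K) i n : (i <= n)%N -> take i (mkseq g n) = mkseq g i.
Proof. by move=> hi; rewrite /mkseq -map_take take_iota (minn_idPl hi). Qed.

Section Measure.
Variable a : Zpos_omega.
Implicit Types (s t : seq int) (O C : seq int -> Prop) (E : set (nat -> int)).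

(** * Words in the support and their masses *)

Definition digits i : seq int := [seq Posz j | j <- iota 0 (absz (aval a i)).+1].

Fixpoint box k : seq (seq int) :=
  if k is k'.+1 then [seq rcons s z | s <- box k', z <- digits k'] else [:: [::]].

Lemma aval_gt0 i : 0 < aval a i.
Proof. exact: (valP (a i : Zpos)). Qed.

Lemma mem_digits i z : (z \in digits i) = (0 <= z <= aval a i).
Proof.
have := aval_gt0 i; rewrite /digits; case: (aval a i) => // n _.
apply/mapP/idP => [[j]|].
  by rewrite mem_iota add0n ltnS => /andP[_ h] ->; apply/andP.
by case: z => // j h; exists j => //; rewrite mem_iota add0n ltnS.
Qed.

Lemma digits_rho1 i : \sum_(z <- digits i) rho1 (aval a i) z = 1 :> R.
Proof.
transitivity (\sum_(z <- digits i) ((aval a i + 1)%:~R^-1 : R)).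
  by apply: eq_big_seq => z; rewrite mem_digits /rho1 => ->.
have := aval_gt0 i; rewrite /digits; case: (aval a i) => // n _.
rewrite big_map big_const_seq count_predT size_iota iter_addr_0 -mulr_natl.
by rewrite [(Posz n + 1)%R]addrC -intS mulfV // intr_eq0.
Qed.

Lemma rho1_ge0 k z : 0 <= k -> 0 <= rho1 k z.
Proof.
by move=> k0; rewrite /rho1; case: ifP => // _; rewrite invr_ge0 ler0z addr_ge0.
Qed.

Lemma cyl_mass_ge0 s : 0 <= cyl_mass a s.
Proof. by apply: prodr_ge0 => i _; apply: rho1_ge0; rewrite ltW // aval_gt0. Qed.

Lemma cyl_mass_rcons s z :
  cyl_mass a (rcons s z) = cyl_mass a s * rho1 (aval a (size s)) z.
Proof.
rewrite /cyl_mass -(big_mkord xpredT (fun i => rho1 (aval a i) (nth 0 (rcons s z) i))).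
rewrite size_rcons big_nat_recr //= nth_rcons ltnn eqxx; congr (_ * _).
rewrite big_mkord; apply: eq_bigr => i _; by rewrite nth_rcons ltn_ord.
Qed.

Lemma mem_box_rcons k s z :
  (rcons s z \in box k.+1) = (s \in box k) && (z \in digits k).
Proof.
apply/allpairsP/andP => [[[s' z'] /= [h1 h2 /rcons_inj[-> ->]]]//|[h1 h2]].
by exists (s, z).
Qed.

Lemma box_size k s : s \in box k -> size s = k.
Proof.
elim: k s => [s|k IH s]; first by rewrite inE => /eqP ->.
by case/lastP: s => [/allpairsP[[[|? ?] ?] [_ _]]|s z] //; rewrite mem_box_rcons size_rcons => /andP[/IH ->].
Qed.

Lemma take_box k j s : (k <= j)%N -> s \in box j -> take k s \in box k.
Proof.
move=> kj sj; have es := box_size sj; elim: j s kj sj es => [|j IH] s.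
  by rewrite leqn0 => /eqP ->; rewrite take0 inE.
rewrite leq_eqVlt => /orP[/eqP -> sj es|]; first by rewrite take_oversize ?es.
rewrite ltnS => kj; case/lastP: s => // s z; rewrite mem_box_rcons size_rcons => /andP[h _] [e].
by rewrite -cats1 takel_cat ?e //; exact: IH.
Qed.

Lemma nth_box k s i : s \in box k -> (i < k)%N -> nth 0 s i \in digits i.
Proof.
elim: k s => // k IH s; case/lastP: s => [/box_size//|s z].
rewrite mem_box_rcons => /andP[sb zb]; rewrite nth_rcons (box_size sb) ltnS leq_eqVlt.
by case/orP=> [/eqP ->|h]; [rewrite ltnn eqxx | rewrite h; exact: IH].
Qed.

Lemma mkseq_box (g : nat -> int) k :
  (forall i, (i < k)%N -> g i \in digits i) -> mkseq g k \in box k.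
Proof.
elim: k => [|k IH] h; first by rewrite inE.
by rewrite mkseqS mem_box_rcons IH /= => [|i ik]; apply: h => //; exact: ltnW.
Qed.

Lemma box_uniq k : uniq (box k).
Proof.
elim: k => // k IH; apply: allpairs_uniq => //.
  by rewrite map_inj_uniq ?iota_uniq // => x y [].
by move=> [s z] [s' z'] _ _ /= /rcons_inj[-> ->].
Qed.

Lemma sum_boxS k (F : seq int -> R) :
  \sum_(s <- box k.+1) F s = \sum_(s <- box k) \sum_(z <- digits k) F (rcons s z).
Proof. by rewrite big_allpairs_dep. Qed.

(** This is the product measure of the clopen set of sequences whose prefix of length [k] satisfies
    [C]. *)
Definition mass k C : R := \sum_(s <- box k) (if `[< C s >] then cyl_mass a s else 0).

Lemma mass_ge0 k C : 0 <= mass k C.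
Proof. by apply: sumr_ge0 => s _; case: ifP => // _; exact: cyl_mass_ge0. Qed.

Lemma mass_le k C C' : (forall s, s \in box k -> C s -> C' s) -> mass k C <= mass k C'.
Proof.
move=> h; rewrite /mass !big_seq; apply: ler_sum => s sb; case: asboolP => [/(h s sb) Cs|_].
  by rewrite asboolT.
by case: ifP => // _; exact: cyl_mass_ge0.
Qed.

Lemma mass_eq k C C' : (forall s, s \in box k -> C s <-> C' s) -> mass k C = mass k C'.
Proof. by move=> h; apply: le_anti; rewrite !mass_le // => s /h[]. Qed.

Lemma massS k C C' : (forall s z, s \in box k -> C' (rcons s z) <-> C s) ->
  mass k.+1 C' = mass k C.
Proof.
move=> h; rewrite /mass sum_boxS; apply: eq_big_seq => s sb.
have -> : \sum_(z <- digits k) (if `[< C' (rcons s z) >] then cyl_mass a (rcons s z) else 0) =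
   \sum_(z <- digits k) (if `[< C s >] then cyl_mass a s else 0) * rho1 (aval a k) z.
  apply: eq_bigr => z _; rewrite (asbool_equiv_eq (h s z sb)) cyl_mass_rcons (box_size sb).
  by case: ifP => // _; rewrite mul0r.
by rewrite -mulr_sumr digits_rho1 mulr1.
Qed.

(** Consistency of the levels: the mass of a word is shared among its one-letter extensions, since
    the weights of a digit add up to 1. *)
Lemma mass_take k j C : (k <= j)%N -> mass j (fun t => C (take k t)) = mass k C.
Proof.
elim: j => [|j IH].
  by rewrite leqn0 => /eqP ->; apply: mass_eq => s /box_size/eqP/nilP ->.
rewrite leq_eqVlt => /orP[/eqP ->|].
  by apply: mass_eq => s sb; rewrite take_oversize // (box_size sb).
rewrite ltnS => kj; rewrite -IH //; apply: massS => s z sb.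
by rewrite -cats1 takel_cat // (box_size sb).
Qed.

Lemma mass_setT k : mass k (fun=> True) = 1.
Proof.
have /= -> := mass_take (fun=> True) (leq0n k).
by rewrite /mass /= big_seq1 asboolT // /cyl_mass big_ord0.
Qed.

Lemma mass_le1 k C : mass k C <= 1.
Proof. by rewrite -(mass_setT k); exact: mass_le. Qed.

Lemma mass_setD k C C' : (forall s, C' s -> C s) ->
  mass k (fun s => C s /\ ~ C' s) = mass k C - mass k C'.
Proof.
move=> h; rewrite /mass -sumrB; apply: eq_bigr => s _.
case: (asboolP (C' s)) => [C's|nC'].
  rewrite asboolF; last by case.
  by rewrite asboolT ?subrr //; exact: h.
rewrite subr0; case: (asboolP (C s)) => [Cs|nC]; [by rewrite asboolT | by rewrite asboolF // => -[]].
Qed.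

Lemma mass_setC k C : mass k (fun s => ~ C s) = 1 - mass k C.
Proof. by rewrite -(mass_setT k) -mass_setD //; apply: mass_eq => s _; split=> [|[]]. Qed.

(** * Open sets generated by trees of words, and their coverings *)

Definition upward O := forall s z, O s -> O (rcons s z).

Lemma upward_take O k s : upward O -> O (take k s) -> O s.
Proof.
move=> uO; elim/last_ind: s => // s z IH.
case: (leqP k (size s)) => h; first by rewrite -cats1 takel_cat // => /IH/uO; rewrite cats1.
by rewrite take_oversize // size_rcons.
Qed.

Lemma mass_nondecreasing O k j : upward O -> (k <= j)%N -> mass k O <= mass j O.
Proof.
by move=> uO kj; rewrite -(mass_take O kj); apply: mass_le => s _; exact: upward_take.
Qed.

Definition tree_open O : set (nat -> int) := [set g | exists k, O (mkseq g k)].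

(** For [O] closed under extension, [tree_open O] is the increasing union of its clopen stages, and
    this supremum is its measure. *)
Definition tree_mass O : R := sup (range (fun k => mass k O)).

Lemma mass_le_tree k O : mass k O <= tree_mass O.
Proof.
apply: ub_le_sup; last by exists k.
by exists 1 => _ [j _ <-]; exact: mass_le1.
Qed.

Lemma tree_mass_le O q : (forall k, mass k O <= q) -> tree_mass O <= q.
Proof. by move=> h; apply: ge_sup => [|_ [j _ <-]//]; exists (mass 0 O), 0%N. Qed.

Lemma tree_mass_gt O q : q < tree_mass O <-> exists k, q < mass k O.
Proof.
split=> [h|[k hk]]; last exact: lt_le_trans (mass_le_tree k O).
apply: contrapT => /forallNP hk; move: h; apply/negP; rewrite -leNgt.
by apply: tree_mass_le => k; rewrite leNgt; apply/negP.
Qed.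

Lemma tree_mass_ge0 O : 0 <= tree_mass O.
Proof. exact: le_trans (mass_ge0 0 O) (mass_le_tree 0 O). Qed.

Lemma tree_mass_le1 O : tree_mass O <= 1.
Proof. by apply: tree_mass_le => k; exact: mass_le1. Qed.

(* [mu a E <= q], with the infimum attained, which keeps the computations in [R]. *)
Definition covered E (q : R) := exists s : nat -> seq int,
  E `<=` \bigcup_k cyl (s k) /\ forall n, \sum_(k < n) cyl_mass a (s k) <= q.

Lemma cylE s (g : nat -> int) : cyl s g <-> mkseq g (size s) = s.
Proof.
split=> [h|<- i]; last by rewrite size_mkseq => hi; rewrite nth_mkseq.
apply: (@eq_from_nth _ 0); rewrite size_mkseq // => i hi.
by rewrite nth_mkseq // h.
Qed.

Lemma covered_mass_ge0 E q : covered E q -> 0 <= q.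
Proof. by move=> [s [_ /(_ 0%N)]]; rewrite big_ord0. Qed.

Lemma covered_sub E E' q q' : E `<=` E' -> q' <= q -> covered E' q' -> covered E q.
Proof.
move=> EE' qq' [s [h1 h2]]; exists s; split=> [g /EE'/h1//|n].
exact: le_trans (h2 n) qq'.
Qed.

(** A word with an impossible digit, used to pad sequences of covering words at no cost. *)
Definition null_word : seq int := [:: -1].

Lemma cyl_mass_null_word : cyl_mass a null_word = 0.
Proof. by rewrite /cyl_mass big_ord1 /rho1. Qed.

Lemma covered_cyl s : covered (cyl s) (cyl_mass a s).
Proof.
exists (fun k => if k == 0%N then s else null_word); split=> [g h|[|n]].
- by exists 0%N.
- by rewrite big_ord0 cyl_mass_ge0.
- rewrite big_ord_recl big1 ?addr0 // => i _; exact: cyl_mass_null_word.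
Qed.

Lemma covered_set0 : covered set0 0.
Proof.
by rewrite -cyl_mass_null_word; apply: covered_sub (covered_cyl null_word).
Qed.

Lemma covered_bigcup (E : nat -> set (nat -> int)) (q : nat -> R) Q :
  (forall n, covered (E n) (q n)) -> (forall n, \sum_(k < n) q k <= Q) ->
  covered (\bigcup_n E n) Q.
Proof.
move=> /choice[s hs] hq.
(* [pickle_inv] is injective where it is defined, so that no pair is counted twice in the partial
   sums. *)
exists (fun k => if pickle_inv k is Some p then s p.1 p.2 else null_word).
split=> [g [n _ Eg]|K].
  have [/(_ _ Eg)[m _ sg] _] := hs n.
  by exists (pickle (n, m)) => //; rewrite pickleK_inv.
pose F (p : nat * nat) := cyl_mass a (s p.1 p.2).
pose l : seq (nat * nat) := pmap pickle_inv (iota 0 K).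
have ul : uniq l by apply: (pmap_uniq (@pickle_invK _)); exact: iota_uniq.
have -> : \sum_(k < K) cyl_mass a (if pickle_inv k is Some p then s p.1 p.2 else null_word) =
    \sum_(p <- l) F p.
  rewrite -(big_mkord xpredT (fun k => cyl_mass a
    (if pickle_inv k is Some p then s p.1 p.2 else null_word))) /index_iota subn0 /l.
  elim: (iota 0 K) => [|k r IH]; first by rewrite !big_nil.
  rewrite big_cons IH /=; case: pickle_inv => [p|] /=; first by rewrite big_cons.
  by rewrite cyl_mass_null_word add0r.
(* The finitely many pairs met so far lie in a square of side [B], and the terms are nonnegative, so
   the sum over the square bounds theirs. *)
pose B := (\max_(p <- l) maxn p.1 p.2).+1.
apply: (@le_trans _ _ (\sum_(p <- [seq (i, j) | i <- iota 0 B, j <- iota 0 B]) F p)).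
  have lB : {subset l <= [seq (i, j) | i <- iota 0 B, j <- iota 0 B]}.
    move=> p pl; have : (maxn p.1 p.2 < B)%N.
      exact: (@leq_bigmax_seq _ l xpredT (fun p => maxn p.1 p.2) p pl isT).
    rewrite gtn_max => /andP[h1 h2]; apply/allpairsP; exists p.
    by rewrite !mem_iota; split=> //; case: (p).
  have el : perm_eq [seq p <- [seq (i, j) | i <- iota 0 B, j <- iota 0 B] | p \in l] l.
    apply: uniq_perm => // [|p].
      by apply/filter_uniq/allpairs_uniq; rewrite ?iota_uniq // => -[? ?] [? ?].
    by rewrite mem_filter andb_idr // => /lB.
  rewrite -(perm_big _ el) big_filter [leRHS](bigID (mem l)) lerDl.
  by apply: sumr_ge0 => p _; exact: cyl_mass_ge0.
rewrite big_allpairs_dep; apply: le_trans (hq B).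
rewrite -(big_mkord xpredT q) /index_iota subn0; apply: ler_sum => i _.
have [_ /(_ B)] := hs i; apply: le_trans.
by rewrite -(big_mkord xpredT (fun j => cyl_mass a (s i j))) /index_iota subn0.
Qed.

Lemma covered_setU E E' q q' : covered E q -> covered E' q' -> covered (E `|` E') (q + q').
Proof.
move=> cE cE'; rewrite -bigcup2E.
have q0 := covered_mass_ge0 cE; have q0' := covered_mass_ge0 cE'.
apply: (covered_bigcup (q := fun n => if n == 0%N then q else if n == 1%N then q' else 0)).
  by move=> [|[|n]] //=; exact: covered_set0.
move=> [|[|n]]; first by rewrite big_ord0 addr_ge0.
  by rewrite big_ord1 /= lerDl.
by rewrite !big_ord_recl /= big1 // addr0.
Qed.

(** A point off the support has a prefix of mass zero, and there are only countably many words. *)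
Lemma covered_setC_supp : covered (~` supp_mu a) 0.
Proof.
pose E n := if unpickle n is Some s then
  if cyl_mass a s == 0 then cyl s else set0 else set0.
apply: (@covered_sub _ (\bigcup_n E n) 0 0) => //; last first.
  apply: (covered_bigcup (q := fun=> 0)) => [n|n]; last by rewrite big1.
  rewrite /E; case: unpickle => [s|]; last exact: covered_set0.
  by case: eqP => [<-|_]; [exact: covered_cyl | exact: covered_set0].
move=> g /existsNP[n gn]; exists (pickle (mkseq g n.+1)) => //; rewrite /E pickleK.
have -> : cyl_mass a (mkseq g n.+1) = 0.
  by rewrite mkseqS cyl_mass_rcons size_mkseq /rho1 (negbTE (introN idP gn)) mulr0.
by rewrite eqxx; apply/cylE; rewrite size_mkseq.
Qed.

Lemma covered_clopen k C : covered [set g | C (mkseq g k)] (mass k C).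
Proof.
rewrite /mass -big_mkcond -big_filter.
have cl (l : seq (seq int)) :
    covered [set g | exists2 s, s \in l & cyl s g] (\sum_(s <- l) cyl_mass a s).
  elim: l => [|s l IH].
    by rewrite big_nil; apply: covered_sub covered_set0 => // g [].
  rewrite big_cons; apply: (covered_sub _ _ (covered_setU (covered_cyl s) IH)) => // g.
  by move=> [t]; rewrite in_cons => /orP[/eqP ->|tl] tg; [left | right; exists t].
rewrite -[X in covered _ X]addr0.
apply: (covered_sub _ _ (covered_setU (cl _) covered_setC_supp)) => // g /= Cg.
case: (pselect (supp_mu a g)) => [sg|]; [left | by right].
exists (mkseq g k); last by apply/cylE; rewrite size_mkseq.
rewrite mem_filter asboolT //=; apply: mkseq_box => i _; rewrite mem_digits; exact: sg.
Qed.

Lemma covered_tree_open O q : upward O -> (forall k, mass k O <= q) ->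
  covered (tree_open O) q.
Proof.
move=> uO hq.
(* Split according to the first length at which the tree is entered. The pieces are clopen, and
   their masses telescope to [mass n O]. *)
pose C k t := O t /\ ~ (if k is j.+1 then O (take j t) else False).
apply: (@covered_sub _ (\bigcup_k [set g | C k (mkseq g k)]) q q) => //.
  move=> g [k]; elim: k => [|k IH] Og; first by exists 0%N => //; split.
  case: (pselect (O (mkseq g k))) => [/IH//|nO]; exists k.+1 => //; split=> //=.
  by rewrite mkseqS -cats1 take_size_cat ?size_mkseq.
apply: (covered_bigcup (q := fun k => mass k (C k))) => [k|n]; first exact: covered_clopen.
case: n => [|n]; first by rewrite big_ord0; apply: le_trans (hq 0%N); exact: mass_ge0.
rewrite (_ : \sum_(_ < _) _ = mass n O) //; elim: n => [|n IH].
  by rewrite big_ord1; apply: mass_eq => s _; split=> [[]|Os] //; split.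
rewrite big_ord_recr /= IH [X in _ + X]mass_setD; last by move=> s; exact: upward_take.
by rewrite mass_take // addrC subrK.
Qed.

(** Replace [O'] by a clopen stage [k] that has all but [d] of its mass. What remains of [O] outside
    that stage is again generated by a tree, [P], whose mass is a plain difference. *)
Lemma covered_treeD O O' d : upward O -> upward O' -> (forall s, O' s -> O s) -> 0 < d ->
  covered (tree_open O `\` tree_open O') (tree_mass O - tree_mass O' + d).
Proof.
move=> uO uO' OO' d0.
have [k hk] : exists k, tree_mass O' - d < mass k O'.
  by apply/tree_mass_gt; rewrite ltrBlDr ltrDl.
pose P t := (k <= size t)%N /\ (O t /\ ~ O' (take k t)).
have uP : upward P.
  move=> s z [ks [Os nO']]; split; first by rewrite size_rcons leqW.
  by split; [exact: uO | rewrite -cats1 takel_cat].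
apply: (@covered_sub _ (tree_open P) _ (tree_mass O - tree_mass O' + d)) => //.
  move=> g [[j Oj] nO']; exists (maxn j k); split; first by rewrite size_mkseq leq_maxr.
  split; last by rewrite take_mkseq ?leq_maxr // => h; apply: nO'; exists k.
  by apply: (upward_take (k := j)) => //; rewrite take_mkseq ?leq_maxl.
apply: covered_tree_open => // j.
apply: le_trans (mass_nondecreasing uP (leq_maxl j k)) _; set i := maxn j k.
apply: (@le_trans _ _ (mass i (fun t => O t /\ ~ O' (take k t)))).
  by apply: mass_le => s _ [].
rewrite mass_setD; last by move=> s /(upward_take uO')/OO'.
rewrite mass_take ?leq_maxr //.
have := mass_le_tree i O; move: hk; lra.
Qed.

Lemma sum_geometric_le (d : R) n : 0 <= d -> \sum_(k < n) d / 2 ^+ k.+1 <= d.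
Proof.
move=> d0; have -> : \sum_(k < n) d / 2 ^+ k.+1 = d - d / 2 ^+ n.
  elim: n => [|n IH]; first by rewrite big_ord0 expr0 divr1 subrr.
  rewrite big_ord_recr /= IH exprS; field.
  by rewrite expf_neq0.
by rewrite lerBlDr lerDl divr_ge0 // exprn_ge0.
Qed.

(** The difference is the union of the successive differences from [N] on. Their masses telescope,
    and the errors of the coverings form a geometric series below [d]. *)
Lemma covered_tree_bigcap (U : nat -> seq int -> Prop) N b c d :
  (forall n, upward (U n)) -> (forall n s, U n.+1 s -> U n s) ->
  tree_mass (U N) <= b -> (forall n, c <= tree_mass (U n)) -> 0 < d ->
  covered (tree_open (U N) `\` \bigcap_n tree_open (U n)) (b - c + d).
Proof.
move=> uU dU hb hc d0.
have d2 k : 0 < d / 2 ^+ k.+1 by rewrite divr_gt0 // exprn_gt0.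
apply: (@covered_sub _ (\bigcup_k (tree_open (U (N + k)%N) `\` tree_open (U (N + k).+1)))
  _ (b - c + d)) => //.
  move=> g [gN /existsNP[n /not_implyP[_ gn]]].
  have nested m i : tree_open (U (i + m)%N) `<=` tree_open (U i).
    elim: m => [|m IH]; first by rewrite addn0.
    by rewrite addnS => h [k /dU ?]; apply: IH; exists k.
  have Nn : (N <= n)%N.
    by rewrite leqNgt; apply/negP => /ltnW h; apply: gn; apply: (nested (N - n)%N); rewrite subnKC.
  have e := subnKC Nn; move: e gn; move: (n - N)%N => m <- {n Nn}.
  elim: m => [|m IH]; first by rewrite addn0.
  case: (pselect (tree_open (U (N + m)%N) g)) => [h|/IH//]; rewrite addnS => h'.
  by exists m.
apply: (covered_bigcup (q := fun k => tree_mass (U (N + k)%N) - tree_mass (U (N + k).+1) + d / 2 ^+ k.+1)).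
  by move=> k; exact: (covered_treeD (uU _) (uU _) (@dU _) (d2 _)).
move=> n; rewrite big_split /=; apply: lerD; last by apply: sum_geometric_le; exact: ltW.
rewrite (_ : \sum_(_ < _) _ = tree_mass (U N) - tree_mass (U (N + n)%N)).
  by apply: lerB.
elim: n => [|n IH]; first by rewrite big_ord0 addn0 subrr.
by rewrite big_ord_recr /= IH addnS addrA subrK.
Qed.

(** * Compactness of the support *)

Lemma bounded_witness (I : eqType) (l : seq I) (P : I -> nat -> Prop) :
  (forall i j k, (j <= k)%N -> P i j -> P i k) ->
  (forall i, i \in l -> exists k, P i k) -> exists k, forall i, i \in l -> P i k.
Proof.
move=> mP; elim: l => [|i l IH] h; first by exists 0%N.
have [k hk] := IH (fun j jl => h j (@mem_behead _ (i :: l) j jl)).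
have [j hj] := h i (mem_head _ _).
exists (maxn j k) => x; rewrite in_cons => /orP[/eqP ->|/hk].
  by apply: mP hj; exact: leq_maxl.
by apply: mP; exact: leq_maxr.
Qed.

(* By Koenig's lemma, [t] is dead iff its cylinder does not meet the compact set
   of the elements of [supp_mu a] outside [tree_open O]. *)
Definition dead O t := exists k, forall t', t' \in box (size t + k) ->
  take (size t) t' = t -> O t'.

Lemma not_dead_box O t : ~ dead O t -> t \in box (size t) /\ ~ O t.
Proof.
move=> nd; split.
  apply: contrapT => nb; apply: nd; exists 0%N => t'; rewrite addn0 => b e.
  by case: nb; move: (b); rewrite take_oversize ?(box_size b) // in e; rewrite e.
move=> Ot; apply: nd; exists 0%N => t'; rewrite addn0 => b.
by rewrite take_oversize ?(box_size b) // => ->.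
Qed.

(** Only finitely many digits are allowed after [t]. If all these extensions were dead, one length
    would witness it for all of them, and [t] would be dead too. *)
Lemma not_dead_rcons O t : upward O -> ~ dead O t ->
  exists j : nat, ~ dead O (rcons t (Posz j)).
Proof.
move=> uO nd; apply: contrapT => /forallNP h; apply: nd.
have [K hK] : exists K, forall z, z \in digits (size t) ->
    forall t', t' \in box ((size t).+1 + K) -> take (size t).+1 t' = rcons t z -> O t'.
  apply: bounded_witness => [z j k jk hj t' b e|z].
    have jk' : ((size t).+1 + j <= (size t).+1 + k)%N by rewrite leq_add2l.
    apply: (upward_take (k := ((size t).+1 + j)%N)) => //.
    by apply: hj; rewrite ?take_box ?take_takel ?leq_addr //; exact: take_box b.
  case: z => j; rewrite mem_digits // => _; have [k hk] := contrapT (h j); exists k => t' b e.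
  by apply: hk; rewrite size_rcons.
exists K.+1 => t' b e; have b' : t' \in box ((size t).+1 + K) by rewrite addSnnS.
have lt : (size t < (size t).+1 + K)%N by rewrite leq_addr.
apply: (hK (nth 0 t' (size t))) => //; first exact: nth_box b' lt.
by rewrite (take_nth 0) ?(box_size b') // e.
Qed.
End Measure.

(** * Leftmost branches *)

Definition least (P : nat -> Prop) : nat :=
  match pselect (exists n, `[< P n >]) with
  | left e => ex_minn e
  | right _ => 0%N
  end.

Lemma leastP (P : nat -> Prop) : (exists n, P n) ->
  P (least P) /\ forall i, (i < least P)%N -> ~ P i.
Proof.
move=> [n Pn]; rewrite /least; case: pselect => [e|[]]; last by exists n; apply/asboolP.
case: ex_minnP => m /asboolP Pm hm; split=> // i im /asboolP /hm.
by rewrite leqNgt im.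
Qed.

Definition next_digit (Q : seq int -> Prop) t : int := Posz (least (fun j => Q (rcons t (Posz j)))).

Fixpoint branch_prefix Q n : seq int :=
  if n is m.+1 then rcons (branch_prefix Q m) (next_digit Q (branch_prefix Q m)) else [::].

Definition branch Q (n : nat) : int := next_digit Q (branch_prefix Q n).

Lemma mkseq_branch Q n : mkseq (branch Q) n = branch_prefix Q n.
Proof. by elim: n => // n IH; rewrite mkseqS IH. Qed.

Lemma branchP (Q : seq int -> Prop) :
  Q [::] -> (forall t, Q t -> exists j : nat, Q (rcons t (Posz j))) ->
  forall n, Q (mkseq (branch Q) n).
Proof.
move=> Q0 QS n; rewrite mkseq_branch; elim: n => // n /QS /leastP[h _].
exact: h.
Qed.

Lemma branch_not_dead a (O : seq int -> Prop) : upward O -> ~ dead a O [::] ->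
  let g := branch (fun t => ~ dead a O t) in supp_mu a g /\ ~ tree_open O g.
Proof.
move=> uO nd g.
have h n : ~ dead a O (mkseq g n).
  by apply: (branchP (Q := fun t => ~ dead a O t)) => // t; exact: not_dead_rcons.
split=> [n|[n On]]; last by have [_] := not_dead_box (h n).
have [b _] := not_dead_box (h n.+1); rewrite size_mkseq in b.
by have := nth_box b (ltnSn n); rewrite nth_mkseq // mem_digits.
Qed.

Lemma dead_nil_supp a (O : seq int -> Prop) : dead a O [::] -> supp_mu a `<=` tree_open O.
Proof.
move=> [k hk] g sg; exists k; apply: hk; rewrite ?take0 //.
by apply: mkseq_box => i _; rewrite mem_digits; exact: sg.
Qed.

(* Were the total mass less than 1, the tree of words extending no word of the
   cover would be infinite, and an infinite branch would escape the cover. *)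
Lemma covered_setT_ge1 a q : covered a setT q -> 1 <= q.
Proof.
move=> [s [hs hq]]; pose O t := exists k, take (size (s k)) t = s k.
have uO : upward O.
  move=> t z [k e]; exists k; rewrite -cats1 takel_cat // -{1}e size_take.
  by case: ltnP => // /ltnW.
have [L hL] : dead a O [::].
  apply: contrapT => /(branch_not_dead uO)[_]; apply; set g := branch _.
  have [k _ /cylE e] := hs g I; exists (size (s k)), k.
  by rewrite take_oversize ?size_mkseq.
have [K hK] : exists K, forall t, t \in box a L -> exists2 k, (k < K)%N & take (size (s k)) t = s k.
  apply: bounded_witness => [t i j ij [k ki e]|t tb].
    by exists k => //; exact: leq_trans ij.
  by have [k e] := hL t tb (take0 _); exists k.+1, k.
apply: le_trans (hq K).
(* A word that leaves the support, or is longer than [L], is a prefix of no word in [box a L] and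
   contributes nothing. *)
have cyl_bound t : mass a L (fun t' => take (size t) t' = t) <= cyl_mass a t.
  case: (leqP (size t) L) => tL.
    rewrite (mass_take _ (fun t' => t' = t)) // /mass.
    case: (boolP (t \in box a (size t))) => tb.
      rewrite (bigD1_seq t) ?box_uniq //= asboolT // big1 ?addr0 // => t' /eqP ne.
      by rewrite asboolF.
    rewrite big1_seq ?cyl_mass_ge0 // => t' /andP[_ b]; rewrite asboolF // => e.
    by move: b; rewrite e; apply/negP.
  rewrite (@mass_eq _ _ _ (fun=> False)) => [|t' b]; last first.
    split=> //; rewrite take_oversize ?(box_size b) ?(ltnW tL) // => e.
    by move: tL; rewrite -e (box_size b) ltnn.
  by rewrite /mass big1 ?cyl_mass_ge0 // => *; rewrite asboolF.
apply: (@le_trans _ _ (\sum_(k < K) mass a L (fun t' => take (size (s k)) t' = s k))); last first.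
  exact: ler_sum.
(* After the exchange of sums, each word of length [L] is counted at least once. *)
rewrite /mass exchange_big /= -(mass_setT a L) /mass !big_seq; apply: ler_sum => t tb.
have [k kK e] := hK t tb; rewrite asboolT // (bigD1 (Ordinal kK)) //= asboolT // lerDl.
by apply: sumr_ge0 => i _; case: ifP => // _; exact: cyl_mass_ge0.
Qed.

Lemma mu_null_covered a (B : set Z_omega) d :
  0 < d -> ~ (0 < mu a B)%E -> covered a B d.
Proof.
move=> d0 /negP; rewrite -leNgt => h.
have : (mu a B < d%:E)%E by apply: le_lt_trans h _; rewrite lte_fin.
rewrite /mu => /ereal_inf_lt[_ /= [s Bs <-] lt]; exists s; split=> // n.
rewrite -lee_fin; apply: le_trans (ltW lt).
rewrite -sumEFin -(big_mkord xpredT (fun k => (cyl_mass a (s k))%:E)).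
by apply: nneseries_lim_ge => k _ _; rewrite lee_fin cyl_mass_ge0.
Qed.

(** * Approximation and selection *)

Lemma eq_box (a a' : Zpos_omega) k : (forall i, (i < k)%N -> a i = a' i) -> box a k = box a' k.
Proof.
elim: k => //= k IH h; rewrite IH => [|i ik]; last by apply: h; exact: leqW.
by rewrite /digits /aval h.
Qed.

Lemma eq_cyl_mass (a a' : Zpos_omega) s :
  (forall i, (i < size s)%N -> a i = a' i) -> cyl_mass a s = cyl_mass a' s.
Proof. by move=> h; apply: eq_bigr => i _; rewrite /aval h. Qed.

Lemma eq_mass (a a' : Zpos_omega) k (C : seq int -> Prop) :
  (forall i, (i < k)%N -> a i = a' i) -> mass a k C = mass a' k C.
Proof.
move=> h; rewrite /mass (eq_box h); apply: eq_big_seq => s /box_size sk.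
by rewrite (@eq_cyl_mass a a') // sk.
Qed.

Lemma clopen_exists_lt (T : topologicalType) (F : nat -> set T) n :
  (forall i, clopen (F i)) -> clopen [set x | exists2 i, (i < n)%N & F i x].
Proof.
move=> cF; elim: n => [|n IH].
  rewrite (_ : [set _ | _] = set0); first exact: clopen0.
  by rewrite eqEsubset; split=> // x [].
rewrite (_ : [set _ | _] = [set x | exists2 i, (i < n)%N & F i x] `|` F n).
  exact: clopenU.
rewrite eqEsubset; split=> x /=.
  by move=> [i]; rewrite ltnS leq_eqVlt => /orP[/eqP ->|h] Fx; [right | left; exists i].
by move=> [[i h Fx]|Fx]; [exists i => //; exact: leqW | exists n].
Qed.

Lemma clopen_cyl s : clopen (cyl s : set Z_omega).
Proof.
apply: (@finite_dep_clopen (discrete_topology int) _ (size s)) => x y h hx i hi.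
by rewrite -h // hx.
Qed.

Section Approximation.
Variable Y : topologicalType.
Hypothesis Yb : clopen_based Y.
Local Notation X := (Zpos_omega * Y)%type.

Let Xb : clopen_based X := clopen_based_prod clopen_based_Zpos Yb.

Let XZb : clopen_based (X * Z_omega)%type := clopen_based_prod Xb clopen_based_Z.

Lemma clopen_fst (A : set Zpos_omega) : clopen A -> clopen [set p : X | A p.1].
Proof.
by move=> cA; apply: (preimage_clopen (f := fst)) => // p; exact: cvg_fst.
Qed.

(** As [Q] is upward closed, the condition says that some finite set [T] of words has enough mass
    and lies inside the tree. The former is clopen in [a], as only its first [k] entries matter; the
    latter is a finite intersection. A general [Q] covers both strict and weak bounds. *)
Lemma mass_Sigma0 eta (w : seq int -> set X) k (Q : R -> Prop) :
  (forall s, Sigma0 eta (w s)) -> (forall x y, x <= y -> Q x -> Q y) ->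
  Sigma0 eta [set p : X | Q (mass p.1 k (w^~ p))].
Proof.
move=> sw mQ; have h1 := Sigma0_ge1 (sw [::]).
rewrite (_ : [set p | _] = \bigcup_(T : seq (seq int))
  ([set p : X | Q (mass p.1 k (fun s => s \in T))] `&` [set p | forall s, s \in T -> w s p])).
  apply: Sigma0_bigcupT => // T; apply: Sigma0_setI => //; last exact: Sigma0_bigcap_seq.
  apply: clopen_Sigma0 => //.
  apply: (clopen_fst (A := [set a | Q (mass a k (fun s => s \in T))])).
  by apply: (@finite_dep_clopen (discrete_topology Zpos) _ k) => a a' h; rewrite /= (eq_mass _ h).
rewrite eqEsubset; split=> p /=.
  move=> Qp; exists [seq s <- box p.1 k | `[< w s p >]] => //; split=> /=.
    move: Qp; congr (Q _); apply: mass_eq => s sb.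
    by rewrite mem_filter sb andbT; split=> [?|/asboolP//]; apply/asboolP.
  by move=> s; rewrite mem_filter => /andP[/asboolP].
move=> [T _ [/= QT hT]]; apply: mQ QT; apply: mass_le => s _; exact: hT.
Qed.

Lemma tree_mass_gt_Sigma0 eta (w : seq int -> set X) r :
  (forall s, Sigma0 eta (w s)) ->
  Sigma0 eta [set p : X | r < tree_mass p.1 (w^~ p)].
Proof.
move=> sw.
rewrite (_ : [set p | _] = \bigcup_k [set p : X | r < mass p.1 k (w^~ p)]).
  apply: Sigma0_bigcup => // k.
  by apply: (@mass_Sigma0 eta w k (fun x => r < x)) => // x y xy rx; exact: lt_le_trans xy.
rewrite eqEsubset; split=> p /=.
  by move/tree_mass_gt => [k ?]; exists k.
by move=> [k _ ?]; apply/tree_mass_gt; exists k.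
Qed.

(** A box takes countably many values, each on a clopen set of [a]. Once it is fixed, being dead at
    depth [k] is a finite conjunction of conditions [w s]. *)
Lemma dead_Sigma0 eta (w : seq int -> set X) t :
  (forall s, Sigma0 eta (w s)) -> Sigma0 eta [set p : X | dead p.1 (w^~ p) t].
Proof.
move=> sw; have h1 := Sigma0_ge1 (sw [::]).
rewrite (_ : [set p | _] = \bigcup_(i : nat * seq (seq int))
  ([set p : X | box p.1 (size t + i.1) = i.2] `&`
   [set p | forall s, s \in [seq s <- i.2 | take (size t) s == t] -> w s p])).
  apply: Sigma0_bigcupT => // -[k T] /=.
  apply: Sigma0_setI => //; last exact: Sigma0_bigcap_seq.
  apply: clopen_Sigma0 => //.
  apply: (clopen_fst (A := [set a | box a (size t + k) = T])).
  apply: (@finite_dep_clopen (discrete_topology Zpos) _ (size t + k)) => a a' h.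
  by rewrite /= (eq_box h).
rewrite eqEsubset; split=> p /=.
  move=> [k hk]; exists (k, box p.1 (size t + k)) => //; split=> //= s.
  by rewrite mem_filter => /andP[/eqP e b]; exact: hk.
move=> [[k T] _ [/= <- h]]; exists k => s b e; apply: h.
by rewrite mem_filter b e eqxx.
Qed.

(** * Outer approximation of Borel sets, uniform in the parameter *)

Definition Sigma0_tree eta (w : seq int -> set X) :=
  (forall s, Sigma0 eta (w s)) /\ (forall p, upward (w^~ p)).

Definition approximable eta (A : set (X * Z_omega)) := forall e : R, 0 < e ->
  exists w, [/\ Sigma0_tree eta w,
    (forall p g, A (p, g) -> tree_open (w^~ p) g) &
    (forall p : X, covered p.1 [set g | tree_open (w^~ p) g /\ ~ A (p, g)] e)].

(** Some [U N] is close to the intersection, but [N] depends on [p]. Since [r < tree_mass] is both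
    [Sigma0 eta] and [Pi0 eta], the choice of [N] costs one level only. *)
Lemma approximable_bigcap eta (U : nat -> seq int -> set X) (e : R) :
  (forall n, Sigma0_tree eta (U n)) -> (forall n s, U n.+1 s `<=` U n s) ->
  (forall n r, Pi0 eta [set p : X | r < tree_mass p.1 ((U n)^~ p)]) -> 0 < e ->
  exists v, [/\ Sigma0_tree (OS eta) v,
    (forall p g, (forall n, tree_open ((U n)^~ p) g) -> tree_open (v^~ p) g) &
    (forall p : X, covered p.1
       (tree_open (v^~ p) `\` \bigcap_n tree_open ((U n)^~ p)) (e + e))].
Proof.
move=> hU dU hm e0; have h1 := Sigma0_ge1 ((hU 0%N).1 [::]).
have h1' := ord_le_trans h1 (ord_le_OS eta).
have nested n m s : (n <= m)%N -> U m s `<=` U n s.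
  move=> nm; rewrite -(subnKC nm); elim: (m - n)%N => [|k IH]; first by rewrite addn0.
  by rewrite addnS => p /dU/IH.
(* For the first multiple [j * e] of [e] that bounds some [m (U N)] from above, all
   [m (U n)] exceed [j * e - e], so [U N] is within [e] of the intersection. *)
pose G N j := [set p : X | tree_mass p.1 ((U N)^~ p) <= j%:R * e] `&`
  [set p : X | forall n, j%:R * e - e < tree_mass p.1 ((U n)^~ p)].
have sG N j : Sigma0 (OS eta) (G N j).
  apply: Sigma0_setI => //.
    rewrite (_ : [set p | _] = ~` [set p : X | j%:R * e < tree_mass p.1 ((U N)^~ p)]).
      apply: (Sigma0_setC_lt (eta := eta)); last exact: ord_le_refl.
      by apply: tree_mass_gt_Sigma0; exact: (hU N).1.
    by rewrite eqEsubset; split=> p /=; rewrite leNgt; move/negP.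
  rewrite -[X in Sigma0 _ X]setCK; apply: (Sigma0_setC_lt (eta := eta)); last exact: ord_le_refl.
  exact: (Pi0_bigcap Xb (A := fun n => [set p | _ < tree_mass p.1 ((U n)^~ p)]) h1 (hm^~ _)).
have exG (p : X) : exists N j, G N j p.
  pose P j := exists N, tree_mass p.1 ((U N)^~ p) <= j%:R * e.
  have exP : exists j, P j.
    exists (Num.bound e^-1), 0%N; apply: le_trans (tree_mass_le1 _ _) _.
    rewrite -ler_pdivrMr // div1r ltW //.
    by apply: archi_boundP; rewrite invr_ge0 ltW.
  have [[N hN] jmin] := leastP exP; exists N, (least P); split=> //= n.
  case ej: (least P) => [|j].
    by rewrite mul0r sub0r; apply: lt_le_trans (tree_mass_ge0 _ _); rewrite oppr_lt0.
  rewrite ltNge; apply/negP => hle; apply: (jmin j); first by rewrite ej.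
  by exists n; apply: le_trans hle _; rewrite -natr1 mulrDl mul1r addrK.
pose v s := \bigcup_(i : nat * nat) (G i.1 i.2 `&` U i.1 s).
exists v; split.
- split=> [s|p s z [[N j] _ [/= GN Us]]]; last by exists (N, j) => //; split=> //; exact: (hU N).2.
  apply: Sigma0_bigcupT => // -[N j] /=; apply: Sigma0_setI => //.
  exact: Sigma0_le ((hU N).1 s) (ord_le_OS eta).
- move=> p g hg; have [N [j Gp]] := exG p; have [k Uk] := hg N.
  by exists k; exists (N, j).
move=> p; have [[j Gp] Nmin] := leastP (exG p).
set N := least _ in Gp Nmin.
(* Every [U M] occurring in [v] at [p] has [N <= M], hence is contained in [U N]. One [e] is the gap
   between the two bounds on the masses, the other is the allowance of the covering. *)
apply: (@covered_sub _ _ (tree_open ((U N)^~ p) `\` \bigcap_n tree_open ((U n)^~ p))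
  _ (j%:R * e - (j%:R * e - e) + e)) => //.
- move=> g [[k [[M i] _ [/= GM Uk]]] ng]; split=> //; exists k.
  apply: nested Uk; rewrite leqNgt; apply/negP => /Nmin; apply; by exists i.
- lra.
apply: (covered_tree_bigcap (U := fun n => (U n)^~ p)) => //.
- by move=> n; exact: (hU n).2.
- by move=> n s; exact: dU.
- by case: Gp.
- by move=> n; apply: ltW; case: Gp => _ /(_ n).
Qed.

(** Basic rectangles inside [A] are enumerated along the word: bounding the index [j] by the length
    of [s] keeps [w s] a finite union, hence clopen. *)
Lemma open_clopen_tree (A : set (X * Z_omega)) : open A ->
  exists w : seq int -> set X, [/\ (forall s, clopen (w s)), (forall p, upward (w^~ p)) &
    forall p g, A (p, g) <-> tree_open (w^~ p) g].
Proof.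
move=> oA; have [C [cC hC]] := Xb.
pose w s := [set p | exists2 j, (j < (size s).+1)%N &
  (if `[< C j `*` cyl s `<=` A >] then C j else set0) p].
exists w; split.
- move=> s; apply: clopen_exists_lt => j; case: ifP => _ //.
  exact: clopen0.
- move=> p s z [j js]; case: asboolP => // CA Cp; exists j; first by rewrite size_rcons leqW.
  rewrite asboolT // => -[x g] /= [Cx gs]; apply: CA; split=> //= i hi.
  by rewrite gs ?size_rcons ?leqW // nth_rcons hi.
move=> p g; split=> [Apg|[k [j _]]]; last first.
  by case: asboolP => // CA Cp; apply: CA; split=> //=; apply/cylE; rewrite size_mkseq.
have : nbhs (p, g) A by exact: open_nbhs_nbhs.
move=> [[P Q] [/= nP nQ] PQ].
move: nP; rewrite nbhsE => -[P' [oP' P'p] P'P].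
have [j Cj CP] := hC _ _ oP' P'p.
have [n hn] := prod_nbhs_finite_dep nQ.
exists (maxn n j), j; first by rewrite size_mkseq ltnS leq_maxr.
rewrite asboolT // => -[x h] /= [Cx /= hh]; apply: PQ; split=> /=.
  by apply: P'P; apply: CP.
apply: hn => i ni; rewrite hh ?size_mkseq ?leq_max ?ni // nth_mkseq //.
by rewrite leq_max ni.
Qed.

Lemma tree_mass_stable (a : Zpos_omega) (O : seq int -> Prop) n :
  tree_mass a (fun s => (n <= size s)%N /\ ~ O (take n s)) = 1 - mass a n O.
Proof.
rewrite -mass_setC; set P := fun s => _.
have uP : upward P.
  by move=> s z [ns nO]; rewrite /P size_rcons leqW // -cats1 takel_cat.
have e k : (n <= k)%N -> mass a k P = mass a n (fun s => ~ O s).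
  move=> nk; rewrite -(mass_take _ (fun s => ~ O s) nk); apply: mass_eq => s sb.
  by rewrite /P (box_size sb); split=> [[]|].
apply: le_anti; rewrite -{2}(e n) // mass_le_tree andbT.
apply: tree_mass_le => k; apply: le_trans (mass_nondecreasing _ uP (leq_maxl k n)) _.
by rewrite e // leq_maxr.
Qed.

Lemma open_approximable eta (A : set (X * Z_omega)) : ord_le ord1 eta -> open A ->
  approximable eta A /\ approximable (OS eta) (~` A).
Proof.
move=> h1 /open_clopen_tree[w [cw uw Aw]]; split=> e e0.
  exists w; split=> [|p g /Aw//|p].
    by split=> // s; exact: clopen_Sigma0.
  by apply: covered_sub (covered_set0 _) => [g [/Aw]|]; last exact: ltW.
(* The complement of [A] is the decreasing intersection of the clopen conditions that the prefix of
   length [n] has not yet entered the tree. *)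
pose U n s := [set p : X | (n <= size s)%N /\ ~ w (take n s) p].
have [] := @approximable_bigcap eta U (e / 2).
- move=> n; split=> [s|p s z [ns nw]].
    case: (leqP n (size s)) => ns; apply: clopen_Sigma0 => //.
      rewrite (_ : U n s = ~` w (take n s)); first exact: clopen_setC.
      by rewrite eqEsubset; split=> p //= [].
    rewrite (_ : U n s = set0); first exact: clopen0.
    by rewrite eqEsubset; split=> p // []; rewrite leqNgt ns.
  by rewrite /U /= size_rcons leqW // -cats1 takel_cat.
- move=> n s p [ns nw]; split; first exact: ltnW.
  by move=> h; apply: nw; rewrite (take_nth 0) //; exact: uw.
- move=> n r; rewrite /Pi0.
  rewrite (_ : ~` _ = [set p : X | 1 - r <= mass p.1 n (w^~ p)]).
    apply: (@mass_Sigma0 eta w n (fun x => 1 - r <= x)) => [s|x y xy rx].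
      exact: clopen_Sigma0.
    exact: le_trans xy.
  rewrite eqEsubset; split=> p /=; rewrite (tree_mass_stable p.1 (w^~ p)).
    by move/negP; rewrite -leNgt; lra.
  by move=> h; apply/negP; rewrite -leNgt; lra.
- by rewrite divr_gt0.
have capU p g : (forall n, tree_open ((U n)^~ p) g) <-> ~ A (p, g).
  split=> [h /Aw[n wn]|nA n].
    have [k []] := h n; rewrite size_mkseq => nk; by rewrite take_mkseq.
  exists n; split; first by rewrite size_mkseq.
  by rewrite take_oversize ?size_mkseq // => h; apply: nA; apply/Aw; exists n.
move=> v [sv hv cv]; exists v; split=> // p.
  by move=> g /capU; exact: hv.
apply: (covered_sub _ _ (cv p)) => [g [vg nA]|]; last by lra.
by split=> // h; apply: nA; apply/capU => n; exact: h.
Qed.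

(* The second half is what makes the induction work: for [A] the union of the
   [B n], the first half applied to the sets [~` B n] gives the second half for
   [A], while the second half for [~` B n] gives the first half for [A]. *)
Lemma Sigma0_approximable eta (A : set (X * Z_omega)) : Sigma0 eta A ->
  approximable eta A /\ approximable (OS eta) (~` A).
Proof.
elim=> {eta A}[eta A h1 _ oA|xi eta B lt1 heta _ IH]; first exact: open_approximable.
have h1 := ord_ltW lt1.
split=> e e0.
  (* The induction hypothesis gives [B n], as a complement, a tree of rank [OS (eta n)], which is at
     most [xi]. *)
  have /choice[w hw] : forall n, exists w, [/\ Sigma0_tree (OS (eta n)) w,
      (forall p g, B n (p, g) -> tree_open (w^~ p) g) &
      (forall p : X, covered p.1 [set g | tree_open (w^~ p) g /\ ~ B n (p, g)] (e / 2 ^+ n.+1))].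
    move=> n; have [_] := IH n; rewrite setCK; apply.
    by rewrite divr_gt0 // exprn_gt0.
  exists (fun s => \bigcup_n w n s); split.
  - split=> [s|p s z [n _ ws]]; last by exists n => //; have [[_ h] _ _] := hw n; exact: h.
    apply: Sigma0_bigcup => // n; have [[h _] _ _] := hw n.
    by apply: Sigma0_le (h s) _ => //; case: (heta n).
  - move=> p g [n _ Bn]; have [_ /(_ _ _ Bn)[k wk] _] := hw n.
    by exists k; exists n.
  move=> p; apply: (@covered_sub _ _
    (\bigcup_n [set g | tree_open ((w n)^~ p) g /\ ~ B n (p, g)]) _ e) => //.
    move=> g [[k [n _ wk]] nB]; exists n => //; split; first by exists k.
    by move=> h; apply: nB; exists n.
  apply: (covered_bigcup (q := fun n => e / 2 ^+ n.+1)) => [n|n].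
    by have [_ _] := hw n; apply.
  by apply: sum_geometric_le; exact: ltW.
have /choice[w hw] : forall n, exists w, [/\ Sigma0_tree (eta n) w,
    (forall p g, ~ B n (p, g) -> tree_open (w^~ p) g) &
    (forall p : X, covered p.1 [set g | tree_open (w^~ p) g /\ ~ ~ B n (p, g)]
       (e / 2 / 2 ^+ n.+1))].
  by move=> n; have [h _] := IH n; apply: h; rewrite !divr_gt0 // exprn_gt0.
(* The first [n.+1] approximations are intersected. The result has a rank strictly below [xi], so
   its mass comparisons are [Pi0 xi] as well. *)
pose U n s := [set p | forall i, i \in iota 0 n.+1 -> w i s p].
have sU n : exists2 z, ord_lt z xi & forall s, Sigma0 z (U n s).
  have [z [z1 zxi hz]] := ord_max_lt n heta; exists z => // s.
  apply: Sigma0_bigcap_seq => // i; rewrite mem_iota add0n ltnS => /andP[_ ni].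
  by have [[h _] _ _] := hw i; apply: Sigma0_le (hz _ ni).
have [] := @approximable_bigcap xi U (e / 4).
- move=> n; split=> [s|p s z h i hi].
    by have [z zxi hz] := sU n; apply: Sigma0_le (hz s) (ord_ltW zxi).
  by have [[_ uw] _ _] := hw i; apply: uw; exact: h.
- move=> n s p h i hi; apply: h; move: hi; rewrite !mem_iota !add0n /= => /leq_trans; exact.
- move=> n r; have [z zxi hz] := sU n.
  by apply: (Sigma0_setC_lt (eta := z)) => //; exact: tree_mass_gt_Sigma0.
- by rewrite divr_gt0.
move=> v [sv hv cv]; exists v; split=> // p.
  move=> g nB; apply: hv => n.
  (* One prefix length at which all these finitely many trees have been entered. *)
  apply: bounded_witness => [i j k jk|i _].
    have [[_ uw] _ _] := hw i => h; apply: (@upward_take ((w i)^~ p) j _ (uw p)).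
    by rewrite take_mkseq.
  have [_ h _] := hw i; apply: h => Bi; apply: nB; by exists i.
(* Half of [e] pays for replacing the intersection of the [U n] by [v], the other half for the
   approximations of the complements of the [B n]. *)
apply: (@covered_sub _ _ ((tree_open (v^~ p) `\` \bigcap_n tree_open ((U n)^~ p)) `|`
  \bigcup_n [set g | tree_open ((w n)^~ p) g /\ ~ ~ B n (p, g)]) _ ((e / 4 + e / 4) + e / 2)).
- move=> g [vg nA]; case: (pselect ((\bigcap_n tree_open ((U n)^~ p)) g)) => [h|]; [right|by left].
  have [n _ Bn] := contrapT nA; exists n => //; split=> //=.
  have [k Uk] := h n I; exists k; apply: Uk; by rewrite mem_iota add0n /=.
- lra.
apply: covered_setU => //.
apply: (covered_bigcup (q := fun n => e / 2 / 2 ^+ n.+1)) => [n|n].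
  by have [_ _] := hw n; apply.
by apply: sum_geometric_le; rewrite divr_ge0 // ltW.
Qed.

(** * Measurable selection *)

Lemma Sigma0_selection xi (P : set (X * Z_omega)) (e : R) :
  ord_lt ord1 xi -> Sigma0 xi P -> 0 < e ->
  exists (D : set X) (f : X -> Z_omega), [/\ Sigma0 xi D,
    (forall s, Sigma0 xi [set p | D p /\ cyl s (f p)]),
    (forall p, D p -> supp_mu p.1 (f p) /\ P (p, f p)) &
    (forall p, ~ D p -> covered p.1 [set g | P (p, g)] e)].
Proof.
move=> lt1 sP e0; have h1 := ord_ltW lt1.
have [eta [B [-> heta sB]]] := Sigma0_inv_bigcup XZb lt1 sP.
have /choice[w hw] : forall n, exists w, [/\ Sigma0_tree (eta n) w,
    (forall p g, ~ B n (p, g) -> tree_open (w^~ p) g) &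
    (forall p : X, covered p.1 [set g | tree_open (w^~ p) g /\ ~ ~ B n (p, g)]
       (e / 2 ^+ n.+1))].
  move=> n; have [h _] := Sigma0_approximable (sB n); apply: h.
  by rewrite divr_gt0 // exprn_gt0.
pose alive n (p : X) t := ~ dead p.1 ((w n)^~ p) t.
have s_dead n t : Sigma0 xi [set p | dead p.1 ((w n)^~ p) t].
  have [[h _] _ _] := hw n; apply: Sigma0_le (dead_Sigma0 t h) _ => //.
  by apply: ord_ltW; case: (heta n).
have s_alive n t : Sigma0 xi [set p | alive n p t].
  have [[h _] _ _] := hw n; apply: (Sigma0_setC_lt (eta := eta n)) => //.
    exact: dead_Sigma0.
  by case: (heta n).
pose idx p := least (fun n => alive n p [::]).
pose f (p : X) : Z_omega := branch (alive (idx p) p).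
exists (\bigcup_n [set p | alive n p [::]]), f; split.
- exact: Sigma0_bigcup.
- move=> s.
  (* For fixed [n], the leftmost branch goes from [s] to [rcons s j] exactly when that word is alive
     and [rcons s i] is dead for all [i < j]. Both conditions are [Sigma0 xi], because [eta n] is
     below [xi]. *)
  have sE n : Sigma0 xi [set p | alive n p [::] /\ mkseq (branch (alive n p)) (size s) = s].
    elim/last_ind: s => [|s z IH].
      rewrite (_ : [set p | _] = [set p | alive n p [::]]) //.
      by rewrite eqEsubset; split=> p //= [].
    have al p : alive n p [::] -> forall k, alive n p (mkseq (branch (alive n p)) k).
      move=> h; apply: branchP => // t; apply: not_dead_rcons.
      by have [[_ h'] _ _] := hw n; exact: h'.
    (* The branch takes natural digits only, so a word with a negative last letter is never
       reached. *)
    case: z => j; last first.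
      rewrite (_ : [set p | _] = set0).
        by apply: clopen_Sigma0 => //; exact: clopen0.
      rewrite eqEsubset; split=> p //= [_]; rewrite size_rcons mkseqS => /rcons_inj[_].
      by rewrite /branch /next_digit.
    rewrite (_ : [set p | _] =
       [set p | alive n p [::] /\ mkseq (branch (alive n p)) (size s) = s] `&`
       ([set p | alive n p (rcons s (Posz j))] `&`
        [set p | forall i, i \in iota 0 j -> dead p.1 ((w n)^~ p) (rcons s (Posz i))])).
      apply: Sigma0_setI => //; apply: Sigma0_setI => //.
      exact: (Sigma0_bigcap_seq Xb (A := fun i => [set p | dead p.1 ((w n)^~ p) (rcons s (Posz i))])).
    have uw p : upward ((w n)^~ p) by have [[_ h] _ _] := hw n; exact: h.
    rewrite eqEsubset; split=> p /=; rewrite size_rcons mkseqS.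
      move=> [a0 /rcons_inj[es ej]]; move: (ej); rewrite /branch -mkseq_branch es /next_digit => -[el].
      have as_ : alive n p s by rewrite -es; exact: al.
      have [h1' h2'] := leastP (not_dead_rcons (uw p) as_).
      rewrite el in h1' h2'; split=> //; split=> // i.
      by rewrite mem_iota add0n => /h2' /contrapT.
    move=> [[a0 es] [aj di]]; split=> //; rewrite es; congr rcons.
    rewrite /branch -mkseq_branch es /next_digit; congr Posz.
    have [h1' h2'] := leastP (P := fun i => alive n p (rcons s (Posz i))) (ex_intro _ j aj).
    apply/eqP; rewrite eqn_leq; apply/andP; split; rewrite leqNgt; apply/negP => lt.
      exact: h2' lt aj.
    by apply: h1'; apply: di; rewrite mem_iota add0n.
  (* The index used at [p] is [n] exactly when the empty word is alive for [n] and dead for all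
     smaller indices. *)
  rewrite (_ : [set p | _] = \bigcup_n
     ([set p | alive n p [::] /\ mkseq (branch (alive n p)) (size s) = s] `&`
      [set p | forall i, i \in iota 0 n -> dead p.1 ((w i)^~ p) [::]])).
    apply: Sigma0_bigcup => // n; apply: Sigma0_setI => //.
    exact: (Sigma0_bigcap_seq Xb (A := fun i => [set p | dead p.1 ((w i)^~ p) [::]])).
  rewrite eqEsubset; split=> p /=.
    move=> [[n _ an] /cylE es]; exists (idx p) => //.
    have [h1' h2'] := leastP (P := fun n => alive n p [::]) (ex_intro _ n an).
    split=> //= i; rewrite mem_iota add0n => /h2'; exact: contrapT.
  move=> [n _ [[an es] hn]]; split; first by exists n.
  apply/cylE; rewrite /f; suff -> : idx p = n by [].
  have [h1' h2'] := leastP (P := fun n => alive n p [::]) (ex_intro _ n an).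
  apply/eqP; rewrite eqn_leq; apply/andP; split; rewrite leqNgt; apply/negP => lt.
    exact: h2' lt an.
  by apply: h1'; apply: hn; rewrite mem_iota add0n.
- move=> p [n _ an].
  have [h1' _] := leastP (P := fun n => alive n p [::]) (ex_intro _ n an).
  have [[_ uw] hB _] := hw (idx p).
  (* The branch avoids an open set that contains the complement of [B (idx p)]. *)
  have [sf nf] := branch_not_dead (uw p) h1'; split=> //.
  exists (idx p) => //; apply: contrapT => nB; apply: nf; exact: hB.
move=> p nD.
(* Off the domain the empty word is dead for every [n], so each tree covers the whole support, and
   [B n] meets the support only within the error of its approximation. *)
apply: (@covered_sub _ _ (\bigcup_n [set g | tree_open ((w n)^~ p) g /\ ~ ~ B n (p, g)] `|`
   ~` supp_mu p.1) _ (e + 0)).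
- move=> g [n _ Bn]; case: (pselect (supp_mu p.1 g)) => [sg|]; [left|by right].
  exists n => //; split; last by apply.
  apply: (dead_nil_supp _ sg); apply: contrapT => an; apply: nD; by exists n.
- by rewrite addr0.
apply: covered_setU (covered_setC_supp _).
apply: (covered_bigcup (q := fun n => e / 2 ^+ n.+1)) => [n|n].
  by have [_ _] := hw n; apply.
by apply: sum_geometric_le; exact: ltW.
Qed.
End Approximation.

(** * Diagonalisation against the universal set *)

Theorem theorem4p1 (xi : ord) :
  ord_le ord2 xi ->
  exists (D : set (Zpos_omega * cantor_space))
         (f : Zpos_omega * cantor_space -> Z_omega),
    [/\ psigma_measurable xi D f /\
        (exists P Q : set (Zpos_omega * cantor_space * Z_omega),
            [/\ Pi0 xi P, Pi0 xi Q & pgraph D f = P `\` Q]),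
        (forall (a : Zpos_omega) (x : cantor_space),
            D (a, x) -> supp_mu a (f (a, x))) &
        (forall (a : Zpos_omega) (S : set (cantor_space * Z_omega)),
            Pi0 xi S ->
            pgraph (fun x => D (a, x)) (fun x => f (a, x)) `<=` S ->
            exists x : cantor_space, (0 < mu a (section S x))%E)].
Proof.
move=> lt1; have {}lt1 : ord_lt ord1 xi by [].
have h1 := ord_ltW lt1.
pose X := (Zpos_omega * cantor_space)%type.
have Xb := clopen_based_prod clopen_based_Zpos clopen_based_cantor.
have XZb := clopen_based_prod Xb clopen_based_Z.
have CZb := clopen_based_prod clopen_based_cantor clopen_based_Z.
have [U [sU hU]] := universal_exists CZb h1.
(* The point [x] also serves as a code: for [c] coding the complement of [S], the section at
   [(a, c)] is the complement of [S] at [c]. *)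
pose diag (q : X * Z_omega) := (q.1.2, (q.1.2, q.2)).
have cdiag : continuous diag.
  have c12 : continuous (fun q : X * Z_omega => q.1.2).
    move=> q; apply: (@continuous_comp _ _ _ fst snd); [exact: cvg_fst | exact: cvg_snd].
  apply: continuous_pair => //; apply: continuous_pair => // q; exact: cvg_snd.
(* Any error with [e + e < 1] would do, since two such coverings cannot exhaust the space. *)
have e4 : 0 < 4^-1 :> Rdefinitions.R by rewrite invr_gt0.
have [D [f [sD sf fP nD]]] :=
  Sigma0_selection clopen_based_cantor lt1 (Sigma0_preimage cdiag sU) e4.
exists D, f; split.
- split.
    move=> V oV.
    rewrite (_ : [set x | _] = \bigcup_(s : seq int)
      (if `[< cyl s `<=` V >] then [set p | D p /\ cyl s (f p)] else set0)).
      apply: Sigma0_bigcupT => // s; case: ifP => _ //.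
      by apply: clopen_Sigma0 => //; exact: clopen0.
    rewrite eqEsubset; split=> p /=; last first.
      by move=> [s _]; case: asboolP => // sV [Dp sp]; split=> //; exact: sV.
    move=> [Dp Vp].
    have [n hn] := @prod_nbhs_finite_dep (discrete_topology int) _ _ (open_nbhs_nbhs (conj oV Vp)).
    exists (mkseq (f p) n) => //; rewrite asboolT; first by split=> //; apply/cylE; rewrite size_mkseq.
    move=> g gs; apply: hn => i ni; rewrite gs ?size_mkseq // nth_mkseq //.
  (* Agreement with [f] on all cylinders is required only over [D], which makes it a [Pi0 xi]
     condition. It holds vacuously off [D], and the second set removes those points. *)
  exists [set q | forall s : seq int, ~ ((D q.1 /\ cyl s (f q.1)) /\ ~ cyl s q.2)],
    (~` (fst @^-1` D)); split.
  + apply: (@Pi0_bigcap _ XZb xi (seq int)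
      (fun s => [set q | ~ ((D q.1 /\ cyl s (f q.1)) /\ ~ cyl s q.2)])) => // s.
    rewrite /Pi0 (_ : ~` _ = (fst @^-1` [set p | D p /\ cyl s (f p)]) `&`
       (snd @^-1` (~` (cyl s : set Z_omega)))); last first.
      by rewrite eqEsubset; split=> q //=; [move/contrapT | move=> ? h; exact: h].
    apply: Sigma0_setI => //.
      by apply: Sigma0_preimage => //; move=> q; exact: cvg_fst.
    apply: Sigma0_preimage; first by move=> q; exact: cvg_snd.
    by apply: clopen_Sigma0 => //; apply: clopen_setC; exact: clopen_cyl.
  + rewrite /Pi0 setCK; apply: Sigma0_preimage => //; by move=> q; exact: cvg_fst.
  rewrite eqEsubset; split=> -[p g] /=.
    by move=> [/= Dp <-]; split=> [s [[_ ?] ?]//|/=]; apply.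
  move=> [/= h /contrapT Dp]; split=> //=; apply: functional_extensionality_dep => i.
  have /not_andP[[]|/contrapT/cylE e] := h (mkseq (f p) i.+1).
    by split=> //; apply/cylE; rewrite size_mkseq.
  rewrite size_mkseq in e.
  by have := congr1 (fun s => nth 0 s i) e; rewrite !nth_mkseq.
- by move=> a x /fP[].
move=> a S pS gS; have [c hc] := hU _ pS; exists c.
apply: contrapT => /(@mu_null_covered _ _ 4^-1 e4) cS.
(* Inside the domain, [f (a, c)] would give a point of the graph outside [S]. Outside it, the
   section of [S] and its complement would both be covered with mass [4^-1]. *)
case: (pselect (D (a, c))) => [Dac|/nD cP].
  have [_ Uf] := fP _ Dac.
  have : (~` S) (c, f (a, c)) by rewrite hc.
  by apply; apply: gS.
have /covered_setT_ge1 : covered a setT (4^-1 + 4^-1).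
  apply: (covered_sub _ _ (covered_setU cS cP)) => // g _.
  case: (pselect (S (c, g))) => [|nS]; [by left | right].
  have : (~` S) (c, g) by []. by rewrite hc.
lra.
Qed.
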